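(* Let $X$ be a real analytic orbifold and let $A\subset X$. Then $A$ is a subanalytic subset of $X$ if and only if every point $x$ of $X$ has a neighborhood $U$ such that $A\cap U$ is a projection of a relatively compact semianalytic set, i.e. such that there exist a real analytic orbifold $Y$ and a relatively compact semianalytic subset $B$ of $X\times Y$ with $A\cap U=p(B)$, where $p\colon X\times Y\to X$ is the projection.
   Context: Orbifolds. Let $X$ be a topological space and $n>0$. An $n$-dimensional orbifold chart for an open subset $V$ of $X$ is a triple $(\tilde V,G,\varphi)$ where $\tilde V$ is a connected open subset of $\mathbb{R}^n$, $G$ is a finite group acting on $\tilde V$ by homeomorphisms (not necessarily effectively; $\ker(G)$ denotes the subgroup acting trivially), and $\varphi\colon\tilde V\to V$ is a $G$-invariant map inducing a homeomorphism $\tilde V/G\to V$. If $V_i\subset V_j$, an embedding $(\lambda_{ij},h_{ij})\colon(\tilde V_i,G_i,\varphi_i)\to(\tilde V_j,G_j,\varphi_j)$ consists of an injective homomorphism $h_{ij}\colon G_i\to G_j$ that restricts to an isomorphism $\ker(G_i)\to\ker(G_j)$, and a topological embedding $\lambda_{ij}\colon\tilde V_i\to\tilde V_j$ with $\lambda_{ij}(gx)=h_{ij}(g)\lambda_{ij}(x)$ for all $g\in G_i$, $x\in\tilde V_i$, and $\varphi_j\circ\lambda_{ij}=\varphi_i$. An orbifold atlas on $X$ is a family of orbifold charts $\{(\tilde V_i,G_i,\varphi_i)\}_{i\in I}$ such that the $V_i=\varphi_i(\tilde V_i)$ cover $X$ and such that for any two charts and any $x\in V_i\cap V_j$ there are an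 open neighborhood $V_k\subset V_i\cap V_j$ of $x$ and a chart of the family for $V_k$ which has embeddings into both given charts. An atlas refines another if each of its charts embeds into some chart of the other; two atlases are equivalent if they have a common refinement. An $n$-dimensional orbifold is a paracompact Hausdorff space with an equivalence class of $n$-dimensional orbifold atlases (equivalently, a maximal atlas); orbifolds are assumed to have only countably many connected components. It is real analytic if all chart groups act by real analytic diffeomorphisms and all embeddings $\lambda_{ij}$ are real analytic. An orbifold chart of $X$ means a chart of the maximal real analytic atlas. The product $X\times Y$ of real analytic orbifolds is the real analytic orbifold with atlas consisting of the charts $(\tilde V\times\tilde U,G\times H,\varphi\times\psi)$, where $(\tilde V,G,\varphi)$, $(\tilde U,H,\psi)$ are charts of $X$, $Y$ and $G\times H$ acts diagonally (componentwise). Semianalytic and subanalytic sets in manifolds. Let $M$ be a real analytic manifold. For $U\subset M$ open, $S(C^\omega(U))$ is the smallest family of subsets of $U$ containing all sets $\{x\in U\mid f(x)>0\}$, $f\colon U\to\mathbb{R}$ real analytic, and stable under finite intersections, finite unions and complements. A set $A\subset M$ is semianalytic if every $x\in M$ has an (open) neighborhood $U$ with $A\cap U\in S(C^\omega(U))$. A set $A\subset M$ is subanalytic if every $x\in M$ has a neighborhood $U$ for which there are a real analytic manifold $N$ and a relatively compact semianalytic subset $B$ of $M\times N$ with $A\cap U=p(B)$, where $p\colon M\times N\to M$ is the projection. Relatively compact means having compact closure. Sets in orbifolds. A subset $A$ of a real analytic orbifold $X$ is semianalytic (subanalytic) if for every $x\in X$ there is an orbifold chart $(\tilde V,G,\varphi)$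 of $X$ with $x\in V=\varphi(\tilde V)$ such that $\varphi^{-1}(A\cap V)$ is a semianalytic (subanalytic) subset of the manifold $\tilde V$. *)

(* Defs.v *)
From HB Require Import structures.
From mathcomp Require Import all_boot all_order all_algebra all_fingroup.
From mathcomp Require Import all_classical all_reals all_analysis.

Set Implicit Arguments.
Unset Strict Implicit.
Unset Printing Implicit Defensive.

Import Order.TTheory GRing.Theory Num.Theory.
Import numFieldNormedType.Exports.

Local Open Scope classical_set_scope.
Local Open Scope ring_scope.

(** * General topology *)

Definition paracompact (X : topologicalType) : Prop :=
  forall C : set (set X), C `<=` open -> \bigcup_(U in C) U = setT ->
  exists D : set (set X),
    [/\ D `<=` open,
        \bigcup_(W in D) W = setT,
        (forall W, D W -> exists2 U, C U & W `<=` U) &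
        forall x : X, exists2 N, nbhs x N &
          finite_set [set W | D W /\ W `&` N !=set0]].

Definition countably_many_components (X : topologicalType) : Prop :=
  countable [set connected_component [set: X] x | x in [set: X]].

(** * Real analytic functions and maps on subsets of [R^n] *)

Definition monomial (R : realType) (n : nat) (alpha : {ffun 'I_n -> nat})
    (x : 'rV[R]_n) : R :=
  \prod_(i < n) x 0 i ^+ alpha i.

(* The power series with coefficients [c] converges absolutely at [x], with
   sum [s]; in view of absolute convergence the exhaustion of the set of
   multi-indices by cubes used for the partial sums is immaterial. *)
Definition power_series_sum (R : realType) (n : nat)
    (c : {ffun 'I_n -> nat} -> R) (x : 'rV[R]_n) (s : R) : Prop :=
  summable [set: {ffun 'I_n -> nat}]
    (fun alpha => (c alpha * monomial alpha x)%:E) /\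
  (fun N : nat => \sum_(alpha : {ffun 'I_n -> 'I_N})
     c [ffun i => val (alpha i)] * monomial [ffun i => val (alpha i)] x)
    @ \oo --> s.

Definition analytic_at (R : realType) (n : nat) (f : 'rV[R]_n -> R)
    (a : 'rV[R]_n) : Prop :=
  exists c : {ffun 'I_n -> nat} -> R,
    \forall x \near a, power_series_sum c (x - a) (f x).

(* Only used on open sets [U]; the values of [f] outside [U] are then
   irrelevant. *)
Definition analytic_on (R : realType) (n : nat) (U : set 'rV[R]_n)
    (f : 'rV[R]_n -> R) : Prop :=
  forall a, U a -> analytic_at f a.

Definition analytic_map (R : realType) (n m : nat) (U : set 'rV[R]_n)
    (f : 'rV[R]_n -> 'rV[R]_m) : Prop :=
  forall j : 'I_m, analytic_on U (fun x => f x 0 j).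

(** * Real analytic manifolds *)

(* The values of [mc_map] outside [mc_dom] are irrelevant. *)
Record mchart (R : realType) (n : nat) (M : topologicalType) := MChart {
  mc_dom : set M;
  mc_map : M -> 'rV[R]_n }.

(* The last clause says that [mc_map] is a homeomorphism from [mc_dom] onto its
   image: both being open, their relatively open subsets are the open subsets
   of the ambient space which they contain. *)
Definition manifold_chart (R : realType) (n : nat) (M : topologicalType)
    (c : mchart R n M) : Prop :=
  [/\ open (mc_dom c),
      open (mc_map c @` mc_dom c),
      set_inj (mc_dom c) (mc_map c) &
      forall W, W `<=` mc_dom c -> (open W <-> open (mc_map c @` W))].

Definition analytic_transition (R : realType) (n : nat) (M : topologicalType)
    (c d : mchart R n M) : Prop :=
  exists2 t : 'rV[R]_n -> 'rV[R]_n,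
    analytic_map (mc_map c @` (mc_dom c `&` mc_dom d)) t &
    forall x, mc_dom c x -> mc_dom d x -> t (mc_map c x) = mc_map d x.

Definition analytic_manifold (R : realType) (n : nat) (M : topologicalType)
    (aM : set (mchart R n M)) : Prop :=
  [/\ hausdorff_space M /\ @second_countable M,
      (forall c, aM c -> manifold_chart c),
      (forall x : M, exists2 c, aM c & mc_dom c x) &
      forall c d, aM c -> aM d -> analytic_transition c d].

(* [f] is real analytic on the open set [U]: in each chart [c] of the atlas,
   [f \o (mc_map c)^-1] is real analytic. *)
Definition manifold_analytic (R : realType) (n : nat) (M : topologicalType)
    (aM : set (mchart R n M)) (U : set M) (f : M -> R) : Prop :=
  forall c, aM c ->
    exists2 g : 'rV[R]_n -> R,
      analytic_on (mc_map c @` (U `&` mc_dom c)) g &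
      forall x, U x -> mc_dom c x -> g (mc_map c x) = f x.

Definition prod_mchart (R : realType) (n m : nat) (M N : topologicalType)
    (c : mchart R n M) (d : mchart R m N) : mchart R (n + m) (M * N)%type :=
  MChart (mc_dom c `*` mc_dom d)
         (fun z => row_mx (mc_map c z.1) (mc_map d z.2)).

Definition prod_manifold (R : realType) (n m : nat) (M N : topologicalType)
    (aM : set (mchart R n M)) (aN : set (mchart R m N)) :
    set (mchart R (n + m) (M * N)%type) :=
  [set e | exists c d, [/\ aM c, aN d & e = prod_mchart c d]].

(* The manifold structure of an open subset [V] of [R^n], on the subtype [V]
   with its relative topology. *)
Definition open_manifold (R : realType) (n : nat) (V : set 'rV[R]_n) :
    set (mchart R n V) :=
  [set MChart [set: V] (fun v : V => set_val v)].
Arguments open_manifold {R n} V _.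

(** * Semianalytic and subanalytic subsets of manifolds *)

(* The family S(C^omega(U)), [U] open; complements are taken in [U]. *)
Inductive S_analytic (R : realType) (n : nat) (M : topologicalType)
    (aM : set (mchart R n M)) (U : set M) : set M -> Prop :=
| S_analytic_pos (f : M -> R) : manifold_analytic aM U f ->
    S_analytic aM U [set x | U x /\ 0 < f x]
| S_analytic_setI (A B : set M) : S_analytic aM U A -> S_analytic aM U B ->
    S_analytic aM U (A `&` B)
| S_analytic_setU (A B : set M) : S_analytic aM U A -> S_analytic aM U B ->
    S_analytic aM U (A `|` B)
| S_analytic_setD (A : set M) : S_analytic aM U A ->
    S_analytic aM U (U `\` A).

Definition semianalytic (R : realType) (n : nat) (M : topologicalType)
    (aM : set (mchart R n M)) (A : set M) : Prop :=
  forall x : M, exists2 U, open_nbhs x U & S_analytic aM U (A `&` U).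

Definition relatively_compact (X : topologicalType) (B : set X) : Prop :=
  compact (closure B).

Definition subanalytic (R : realType) (n : nat) (M : topologicalType)
    (aM : set (mchart R n M)) (A : set M) : Prop :=
  forall x : M, exists2 U, nbhs x U &
    exists (m : nat) (N : topologicalType) (aN : set (mchart R m N)),
      analytic_manifold aN /\
      exists B : set (M * N)%type,
        [/\ relatively_compact B,
            semianalytic (prod_manifold aM aN) B &
            A `&` U = fst @` B].

(** * Orbifold charts *)

(* A triple (V~, G, phi); the finite group G is [oc_grp], it acts by [oc_act]
   on the left, and the values of [oc_act] and [oc_map] outside [oc_dom] are
   irrelevant. *)
Record orbchart (R : realType) (n : nat) (X : topologicalType) := OrbChart {
  oc_dom : set 'rV[R]_n;
  oc_grp : finGroupType;
  oc_act : oc_grp -> 'rV[R]_n -> 'rV[R]_n;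
  oc_map : 'rV[R]_n -> X }.
Arguments oc_act {R n X} _ _ _.

Definition oc_img (R : realType) (n : nat) (X : topologicalType)
    (c : orbchart R n X) : set X :=
  oc_map c @` oc_dom c.

Definition oc_ker (R : realType) (n : nat) (X : topologicalType)
    (c : orbchart R n X) : set (oc_grp c) :=
  [set g | forall x, oc_dom c x -> oc_act c g x = x].
Arguments oc_ker {R n X} c _.

Definition chart_action (R : realType) (n : nat) (X : topologicalType)
    (c : orbchart R n X) : Prop :=
  [/\ (forall g x, oc_dom c x -> oc_dom c (oc_act c g x)),
      (forall x, oc_dom c x -> oc_act c 1%g x = x),
      (forall g h x, oc_dom c x ->
         oc_act c (g * h)%g x = oc_act c g (oc_act c h x)) &
      forall g, {within oc_dom c, continuous (oc_act c g)}].

(* The last two clauses of [orbifold_chart] say that the map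
   [oc_dom c / oc_grp c -> oc_img c] induced by [oc_map c] is well defined and
   bijective, and that it is a homeomorphism for the quotient topology: a
   subset of [oc_img c] is open if and only if its inverse image in [oc_dom c]
   is open. *)
Definition orbifold_chart (R : realType) (n : nat) (X : topologicalType)
    (c : orbchart R n X) : Prop :=
  [/\ open (oc_dom c) /\ connected (oc_dom c),
      chart_action c,
      open (oc_img c),
      (forall x y, oc_dom c x -> oc_dom c y ->
         (oc_map c x = oc_map c y <-> exists g, y = oc_act c g x)) &
      forall W, W `<=` oc_img c ->
         (open W <-> open (oc_dom c `&` oc_map c @^-1` W))].

Definition analytic_orbifold_chart (R : realType) (n : nat)
    (X : topologicalType) (c : orbchart R n X) : Prop :=
  orbifold_chart c /\
  forall g, analytic_map (oc_dom c) (oc_act c g).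

Definition topological_embedding (X Y : topologicalType) (U : set X)
    (f : X -> Y) : Prop :=
  {within U, continuous f} /\
  exists2 g : Y -> X, {within f @` U, continuous g} &
    forall x, U x -> g (f x) = x.

Definition chart_embedding (R : realType) (n : nat) (X : topologicalType)
    (c d : orbchart R n X) (lam : 'rV[R]_n -> 'rV[R]_n)
    (h : oc_grp c -> oc_grp d) : Prop :=
  [/\ {morph h : g g' / (g * g')%g} /\ injective h,
      set_bij (oc_ker c) (oc_ker d) h,
      set_fun (oc_dom c) (oc_dom d) lam /\
        topological_embedding (oc_dom c) lam,
      (forall g x, oc_dom c x -> lam (oc_act c g x) = oc_act d (h g) (lam x)) &
      forall x, oc_dom c x -> oc_map d (lam x) = oc_map c x].
Arguments chart_embedding {R n X} c d lam h.

(* A real analytic embedding of an open set of [R^n] into [R^n], in the usual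
   sense of differential topology: a real analytic diffeomorphism onto an open
   subset (thus excluding [x |-> x ^ 3]). *)
Definition analytic_embedding (R : realType) (n : nat) (U : set 'rV[R]_n)
    (lam : 'rV[R]_n -> 'rV[R]_n) : Prop :=
  [/\ analytic_map U lam,
      open (lam @` U) &
      exists2 g : 'rV[R]_n -> 'rV[R]_n, analytic_map (lam @` U) g &
        forall x, U x -> g (lam x) = x].

Definition embeds (R : realType) (n : nat) (X : topologicalType)
    (c d : orbchart R n X) : Prop :=
  exists (lam : 'rV[R]_n -> 'rV[R]_n) (h : oc_grp c -> oc_grp d),
    chart_embedding c d lam h /\ analytic_embedding (oc_dom c) lam.

(** * Real analytic orbifolds *)

(* A family of charts; [set (orbchart R n X)] would be universe inconsistent,
   as [orbchart] quantifies over [finGroupType]. *)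
Definition orbatlas (R : realType) (n : nat) (X : topologicalType) : Type :=
  orbchart R n X -> Prop.

Definition analytic_orbifold_atlas (R : realType) (n : nat)
    (X : topologicalType) (aX : orbatlas R n X) : Prop :=
  [/\ (forall c, aX c -> analytic_orbifold_chart c),
      (forall x : X, exists2 c, aX c & oc_img c x) &
      forall c d x, aX c -> aX d -> oc_img c x -> oc_img d x ->
        exists2 e, aX e &
          [/\ oc_img e x, oc_img e `<=` oc_img c `&` oc_img d,
              embeds e c & embeds e d]].

Definition atlas_refines (R : realType) (n : nat) (X : topologicalType)
    (aX bX : orbatlas R n X) : Prop :=
  forall c, aX c -> exists2 d, bX d & embeds c d.

Definition atlas_equiv (R : realType) (n : nat) (X : topologicalType)
    (aX bX : orbatlas R n X) : Prop :=
  exists cX, [/\ analytic_orbifold_atlas cX, atlas_refines cX aX &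
                 atlas_refines cX bX].

(* A real analytic orbifold is given by a representative [aX] of its
   equivalence class of real analytic atlases. *)
Definition analytic_orbifold (R : realType) (n : nat) (X : topologicalType)
    (aX : orbatlas R n X) : Prop :=
  [/\ (0 < n)%N,
      hausdorff_space X,
      paracompact X,
      countably_many_components X &
      analytic_orbifold_atlas aX].

(* The orbifold charts of X. *)
Definition maximal_atlas (R : realType) (n : nat) (X : topologicalType)
    (aX : orbatlas R n X) : orbatlas R n X :=
  fun c => exists bX, [/\ analytic_orbifold_atlas bX, atlas_equiv aX bX & bX c].

Definition prod_orbchart (R : realType) (n m : nat) (X Y : topologicalType)
    (c : orbchart R n X) (d : orbchart R m Y) :
    orbchart R (n + m) (X * Y)%type :=
  @OrbChart R (n + m) (X * Y)%type
    [set z | oc_dom c (lsubmx z) /\ oc_dom d (rsubmx z)]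
    (oc_grp c * oc_grp d)%type
    (fun g z => row_mx (oc_act c g.1 (lsubmx z)) (oc_act d g.2 (rsubmx z)))
    (fun z => (oc_map c (lsubmx z), oc_map d (rsubmx z))).

Definition prod_orbifold (R : realType) (n m : nat) (X Y : topologicalType)
    (aX : orbatlas R n X) (aY : orbatlas R m Y) :
    orbatlas R (n + m) (X * Y)%type :=
  fun e => exists c d,
    [/\ maximal_atlas aX c, maximal_atlas aY d & e = prod_orbchart c d].

(** * Semianalytic and subanalytic subsets of orbifolds *)

(* phi^-1(A `&` V), as a subset of the manifold V~. *)
Definition chart_preimage (R : realType) (n : nat) (X : topologicalType)
    (c : orbchart R n X) (A : set X) : set (oc_dom c) :=
  [set v : oc_dom c | (A `&` oc_img c) (oc_map c (set_val v))].
Arguments chart_preimage {R n X} c A.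

Definition orb_semianalytic (R : realType) (n : nat) (X : topologicalType)
    (aX : orbatlas R n X) (A : set X) : Prop :=
  forall x : X, exists2 c, maximal_atlas aX c &
    oc_img c x /\
    semianalytic (open_manifold (oc_dom c)) (chart_preimage c A).

Definition orb_subanalytic (R : realType) (n : nat) (X : topologicalType)
    (aX : orbatlas R n X) (A : set X) : Prop :=
  forall x : X, exists2 c, maximal_atlas aX c &
    oc_img c x /\
    subanalytic (open_manifold (oc_dom c)) (chart_preimage c A).

(* Main.v *)
Require Import Defs.
From HB Require Import structures.
From mathcomp Require Import all_boot all_order all_algebra all_fingroup.
From mathcomp Require Import all_classical all_reals all_analysis.
From mathcomp Require Import ring lra.

Set Implicit Arguments.
Unset Strict Implicit.
Unset Printing Implicit Defensive.

Import Order.TTheory GRing.Theory Num.Theory.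
Import numFieldNormedType.Exports.

Local Open Scope classical_set_scope.
Local Open Scope ring_scope.

(** Why the theorem holds.

    Everything is read in charts, where being semianalytic is a local property:
    it is enough to know the germ of a set at each point of a chart
    ([semian_at]). Two facts make this work.

    The first is that germs of semianalytic sets can be pulled back along real
    analytic maps between open subsets of [R^n] ([semian_at_analytic]). This
    rests on the substitution of power series in several variables
    ([analytic_at_comp]). A function is described near a point by a power series
    with a majorant, an upper bound [M] for the sum of the absolute values of
    its terms on the ball of radius [r] ([is_ps]); such functions are closed under products and under
    sums of families with summable majorants ([is_psM], [is_ps_sum]), because
    absolutely summable families can be regrouped at will ([rsum_pair],
    [is_ps_family]). Substitution is a sum of products of this kind, and it
    converges because the majorant of a series without constant term tends to
    [0] with the radius ([is_ps_small]).

    The second is that two charts of an orbifold are related, near any two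
    points over the same point of the orbifold, by a real analytic map
    compatible with the projections ([chart_transition]). Inside one atlas it is
    obtained by composing group elements, embeddings and inverses of embeddings
    ([coherent_atlas]); across equivalent atlases it goes through a common
    refinement ([transition_cross], [coherent_maximal]), and it is inherited by
    products ([coherent_prod]). Hence a set that is semianalytic in some chart
    around each point is semianalytic in every chart
    ([orb_semianalytic_preim]).

    From projections to subanalytic sets ([orb_subanalytic_of_projections]):
    given [B] in [X * Y] with compact closure, finitely many closed balls in
    charts of [Y] have interiors whose images cover the projection of the
    closure to [Y]. Pulling [B] back to a chart of [X] times these balls and
    taking the union, all inside [V * R^m], gives a relatively compact
    semianalytic set whose projection is the part of the preimage of [A] in a
    small ball.

    From subanalytic sets to projections ([projections_of_orb_subanalytic]):
    given [B'] in [V * N] over a chart [c] of [X], the manifold [N] is first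
    replaced by [R^(m + 1)], again by covering the projection of the closure by
    finitely many coordinate balls and taking a union; the spare coordinate
    makes the dimension positive, as required of an orbifold. The set [B] is the
    image in [X * R^(m + 1)] of the result. In the chart [c] its preimage is a
    finite union of translates under the chart group, so it is semianalytic
    there; in any other chart it is so by transition at points lying over the
    compact projection of the closure of [B'], and it is empty near all other
    points. *)

(** * Absolutely convergent families of real numbers *)

Section RealSums.
Variable R : realType.
Implicit Types I J : choiceType.

(** The sum of a family of nonnegative real numbers, possibly infinite. *)
Definition esumr I (f : I -> R) : \bar R := esum [set: I] (fun i => (f i)%:E).

Definition abs_summable I (f : I -> R) : Prop :=
  (esumr (fun i => `|f i|)%R < +oo)%E.

(** The sum of an absolutely convergent family, as a difference of two sums of
    nonnegative families; the value is meaningless for other families. *)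
Definition rsum I (f : I -> R) : R :=
  fine (esumr (fun i => `|f i| + f i)) - fine (esumr (fun i => `|f i|)).

Lemma absD_ge0 (x : R) : 0 <= `|x| + x.
Proof. by have := ler_norm (- x); rewrite normrN; lra. Qed.

Lemma esumr_ge0 I (f : I -> R) : (forall i, 0 <= f i) -> (0 <= esumr f)%E.
Proof. by move=> f0; apply: esum_ge0 => i _; rewrite lee_fin. Qed.

Lemma le_esumr I (f g : I -> R) :
  (forall i, f i <= g i) -> (esumr f <= esumr g)%E.
Proof. by move=> fg; apply: le_esum => i _; rewrite lee_fin. Qed.

Lemma eq_esumr I (f g : I -> R) : f =1 g -> esumr f = esumr g.
Proof. by move=> fg; apply: eq_esum => i _; rewrite fg. Qed.

Lemma eq_rsum I (f g : I -> R) : f =1 g -> rsum f = rsum g.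
Proof. by move=> fg; congr rsum; apply/funext. Qed.

Lemma esumrD I (f g : I -> R) :
  (forall i, 0 <= f i) -> (forall i, 0 <= g i) ->
  (esumr (fun i => f i + g i)%R = esumr f + esumr g)%E.
Proof.
move=> f0 g0; rewrite /esumr -esumD; try by move=> i _; rewrite lee_fin.
by apply: eq_esum => i _; rewrite EFinD.
Qed.

Lemma le_esumrZ I (a : R) (f : I -> R) : 0 <= a -> (forall i, 0 <= f i) ->
  (esumr (fun i => a * f i)%R <= a%:E * esumr f)%E.
Proof.
move=> a0 f0; apply: ge_ereal_sup => _ [F [finF _] <-].
under eq_fsbigr do rewrite EFinM.
rewrite -ge0_mule_fsumr; last by move=> i; rewrite lee_fin.
rewrite lee_wpmul2l ?lee_fin//.
by apply: ereal_sup_ubound; exists F.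
Qed.

Lemma esumrZ I (a : R) (f : I -> R) : 0 <= a -> (forall i, 0 <= f i) ->
  (esumr (fun i => a * f i)%R = a%:E * esumr f)%E.
Proof.
move=> a0 f0; apply/eqP; rewrite eq_le le_esumrZ//=.
have [->|an0] := eqVneq a 0; last have {an0}a0 : 0 < a by rewrite lt_def an0.
  by rewrite mul0e; apply: esumr_ge0 => i; rewrite mul0r.
have -> : esumr f = esumr (fun i => a^-1 * (a * f i)).
  by apply: eq_esumr => i; rewrite mulKf// gt_eqF.
apply: (@le_trans _ _ (a%:E * (a^-1%:E * esumr (fun i => a * f i)%R))%E).
  rewrite lee_wpmul2l ?lee_fin ?(ltW a0)// le_esumrZ ?invr_ge0 ?(ltW a0)// => i.
  by rewrite mulr_ge0// ltW.
by rewrite muleA -EFinM divff ?gt_eqF// mul1e.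
Qed.

Lemma abs_summable_le I (f : I -> R) (g : I -> R) :
  (forall i, `|f i| <= `|g i|) -> abs_summable g -> abs_summable f.
Proof. by move=> fg; apply: le_lt_trans; exact: le_esumr. Qed.

Lemma esumr_fin I (p : I -> R) : (forall i, 0 <= p i) -> abs_summable p ->
  esumr p \is a fin_num.
Proof.
move=> p0 sp; rewrite ge0_fin_numE ?esumr_ge0//.
by apply: le_lt_trans sp; apply: le_esumr => i; rewrite ler_norm.
Qed.

Lemma abs_summable_nng I (p : I -> R) : (forall i, 0 <= p i) ->
  (esumr p < +oo)%E -> abs_summable p.
Proof.
by move=> p0; apply: le_lt_trans; apply: le_esumr => i; rewrite ger0_norm.
Qed.

Lemma abs_summable_norm I (f : I -> R) :
  abs_summable f -> abs_summable (fun i => `|f i|).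
Proof. by apply: abs_summable_le => i; rewrite normr_id. Qed.

Lemma abs_summableD I (f g : I -> R) :
  abs_summable f -> abs_summable g -> abs_summable (fun i => f i + g i).
Proof.
move=> sf sg; apply: (@le_lt_trans _ _ (esumr (fun i => `|f i| + `|g i|))).
  by apply: le_esumr => i; exact: ler_normD.
by rewrite esumrD// lte_add_pinfty.
Qed.

Lemma abs_summableZ I (a : R) (f : I -> R) :
  abs_summable f -> abs_summable (fun i => a * f i).
Proof.
move=> sf; rewrite /abs_summable.
under [X in esumr X]eq_fun do rewrite normrM.
have : esumr (fun i => `|f i|) \is a fin_num.
  by apply: esumr_fin => //; exact: abs_summable_norm.
by rewrite esumrZ// => /fineK <-; rewrite -EFinM ltry.
Qed.

(** The sum can be computed from any decomposition into a difference of
    summable nonnegative families. *)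
Lemma rsum_pq I (f p q : I -> R) :
  (forall i, 0 <= p i) -> (forall i, 0 <= q i) ->
  abs_summable p -> abs_summable q -> (forall i, f i = p i - q i) ->
  rsum f = fine (esumr p) - fine (esumr q).
Proof.
move=> p0 q0 sp sq fpq.
have sf : abs_summable f.
  rewrite (_ : f = fun i => p i + (-1) * q i); last first.
    by apply/funext => i; rewrite fpq; ring.
  exact/abs_summableD/abs_summableZ.
have saf : abs_summable (fun i => `|f i| + f i).
  exact/abs_summableD/sf/abs_summable_norm.
have : (esumr (fun i => `|f i| + f i)%R + esumr q =
        esumr p + esumr (fun i => `|f i|)%R)%E.
  rewrite -!esumrD//; last by move=> i; exact: absD_ge0.
  by apply: eq_esumr => i; rewrite fpq; ring.
have fin1 := esumr_fin (fun i => absD_ge0 (f i)) saf.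
have fin2 := esumr_fin (fun i => normr_ge0 (f i)) (abs_summable_norm sf).
have fin3 := esumr_fin p0 sp; have fin4 := esumr_fin q0 sq.
rewrite /rsum; move: (esumr _) (esumr _) (esumr p) (esumr q) fin1 fin2 fin3 fin4.
by case=> [a| |]//; case=> [b| |]//; case=> [c| |]//; case=> [d| |]// _ _ _ _ [/=]; lra.
Qed.

Lemma rsum_nng I (f : I -> R) : (forall i, 0 <= f i) -> abs_summable f ->
  rsum f = fine (esumr f).
Proof.
move=> f0 sf; rewrite (@rsum_pq _ f f (fun=> 0))//; last first.
- by move=> i; rewrite subr0.
- by apply: abs_summable_le sf => i; rewrite normr0.
- by rewrite [esumr (fun=> 0)]esum1// subr0.
Qed.

Lemma rsumD I (f g : I -> R) : abs_summable f -> abs_summable g ->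
  rsum (fun i => f i + g i) = rsum f + rsum g.
Proof.
move=> sf sg.
have saf : abs_summable (fun i => `|f i| + f i).
  exact/abs_summableD/sf/abs_summable_norm.
have sag : abs_summable (fun i => `|g i| + g i).
  exact/abs_summableD/sg/abs_summable_norm.
rewrite (@rsum_pq _ _ (fun i => (`|f i| + f i) + (`|g i| + g i))
   (fun i => `|f i| + `|g i|)); last first.
- by move=> i; ring.
- by apply: abs_summableD; apply: abs_summable_norm.
- exact: abs_summableD.
- by move=> i; rewrite addr_ge0.
- by move=> i; rewrite addr_ge0// absD_ge0.
- rewrite (esumrD (fun i => absD_ge0 (f i)) (fun i => absD_ge0 (g i))).
  rewrite (esumrD (fun i => normr_ge0 (f i)) (fun i => normr_ge0 (g i))).
  rewrite !fineD; try (apply: esumr_fin => //; try exact: abs_summable_norm;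
    try by move=> i; exact: absD_ge0).
  by rewrite /rsum; ring.
Qed.

Lemma rsumN I (f : I -> R) : abs_summable f -> rsum (fun i => - f i) = - rsum f.
Proof.
move=> sf; rewrite (@rsum_pq _ _ (fun i => `|f i|) (fun i => `|f i| + f i))//.
- by rewrite /rsum opprB.
- by move=> i; exact: absD_ge0.
- exact: abs_summable_norm.
- exact/abs_summableD/sf/abs_summable_norm.
- by move=> i; ring.
Qed.

Lemma rsumZ I (a : R) (f : I -> R) : abs_summable f ->
  rsum (fun i => a * f i) = a * rsum f.
Proof.
move=> sf; wlog a0 : a / 0 <= a => [H|].
  have [/H//|/ltW a0] := leP 0 a.
  rewrite -[a]opprK mulNr -H ?oppr_ge0// -rsumN; last exact: abs_summableZ.
  by apply: eq_rsum => i; ring.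
have saf : abs_summable (fun i => `|f i| + f i).
  exact/abs_summableD/sf/abs_summable_norm.
rewrite (@rsum_pq _ _ (fun i => a * (`|f i| + f i)) (fun i => a * `|f i|)).
- rewrite (esumrZ a0 (fun i => absD_ge0 (f i))).
  rewrite (esumrZ a0 (fun i => normr_ge0 (f i))).
  rewrite !fineM//; try (apply: esumr_fin => //; try exact: abs_summable_norm;
    try by move=> i; exact: absD_ge0).
  by rewrite /rsum /= mulrBr.
- by move=> i; rewrite mulr_ge0// absD_ge0.
- by move=> i; rewrite mulr_ge0.
- exact: abs_summableZ.
- exact/abs_summableZ/abs_summable_norm.
- by move=> i; ring.
Qed.

Lemma ler_norm_rsum I (f : I -> R) : abs_summable f ->
  `|rsum f| <= fine (esumr (fun i => `|f i|)).
Proof.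
move=> sf; have sn := abs_summable_norm sf.
have sp : abs_summable (fun i => `|f i| + f i) by exact: abs_summableD.
have fn := esumr_fin (fun i => normr_ge0 (f i)) sn.
have fp := esumr_fin (fun i => absD_ge0 (f i)) sp.
have h1 : 0 <= fine (esumr (fun i => `|f i| + f i)).
  by apply/fine_ge0/esumr_ge0 => i; exact: absD_ge0.
have h2 : fine (esumr (fun i => `|f i| + f i)) <=
    fine (esumr (fun i => `|f i|)) + fine (esumr (fun i => `|f i|)).
  rewrite -fineD// -esumrD// fine_le//.
    by rewrite esumrD// fin_numD fn.
  by apply: le_esumr => i; rewrite lerD2l ler_norm.
by rewrite /rsum ler_norml; lra.
Qed.

Lemma abs_summable1 I (i0 : I) (a : R) :
  abs_summable (fun i => if i == i0 then a else 0).
Proof.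
rewrite /abs_summable /esumr (esumID [set i0]); last by move=> i _; rewrite lee_fin.
rewrite setTI esum_set1 ?lee_fin// eqxx esum1 ?adde0 ?ltry// => i [_ /eqP/negPf/= ->].
by rewrite normr0.
Qed.

Lemma rsum1 I (i0 : I) (a : R) : rsum (fun i => if i == i0 then a else 0) = a.
Proof.
wlog a0 : a / 0 <= a => [H|].
  have [/H//|/ltW a0] := leP 0 a.
  rewrite -[RHS]opprK -(H (- a)) ?oppr_ge0// -rsumN; last exact: abs_summable1.
  by apply: eq_rsum => i; case: ifP; rewrite ?opprK ?oppr0.
rewrite rsum_nng; [|by move=> i; case: ifP|exact: abs_summable1].
rewrite /esumr (esumID [set i0]); last by move=> i _; rewrite lee_fin; case: ifP.
by rewrite setTI esum_set1 ?lee_fin ?eqxx// esum1 ?adde0// => i [_ /eqP/negPf/= ->].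
Qed.

Lemma esumr_pair I J (p : I * J -> R) : (forall k, 0 <= p k) ->
  esumr p = esum [set: I] (fun i => esumr (fun j => p (i, j))).
Proof.
move=> p0; rewrite /esumr esum_esum; last by move=> i j _ _; rewrite lee_fin.
rewrite (_ : [set: I] `*`` _ = [set: I * J]%type).
  by apply: eq_esum => -[i j].
by apply/seteqP; split.
Qed.

(** Tonelli: the sum over pairs, with finite inner sums. *)
Lemma esumr_pair_fine I J (p : I * J -> R) : (forall k, 0 <= p k) ->
  (esumr p < +oo)%E ->
  [/\ forall i, abs_summable (fun j => p (i, j)),
      abs_summable (fun i => fine (esumr (fun j => p (i, j)))) &
      esumr p = esumr (fun i => fine (esumr (fun j => p (i, j))))].
Proof.
move=> p0 sp.
have ge i : (0 <= esumr (fun j => p (i, j)))%E by exact: esumr_ge0.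
have fin i : esumr (fun j => p (i, j)) \is a fin_num.
  rewrite ge0_fin_numE//; apply: le_lt_trans sp.
  rewrite esumr_pair// (esumID [set i])// setTI esum_set1//.
  by rewrite leeDl// esum_ge0.
have E : esumr p = esumr (fun i => fine (esumr (fun j => p (i, j)))).
  by rewrite esumr_pair//; apply: eq_esum => i _; rewrite fineK.
split=> // [i|].
- by apply: abs_summable_nng => //; rewrite ltey_eq fin.
- by apply: abs_summable_nng; [move=> i; exact/fine_ge0 | rewrite -E].
Qed.

Lemma abs_summable_pair I J (f : I * J -> R) : abs_summable f ->
  (forall i, abs_summable (fun j => f (i, j))) /\
  abs_summable (fun i => rsum (fun j => f (i, j))).
Proof.
move=> sf; have [s1 s2 _] := esumr_pair_fine (fun k => normr_ge0 (f k)) sf.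
have s i : abs_summable (fun j => f (i, j)).
  by apply: abs_summable_le (s1 i) => j; rewrite normr_id.
split => //; apply: abs_summable_le s2 => i.
by rewrite (le_trans (ler_norm_rsum _))// ler_norm.
Qed.

(** Fubini for absolutely summable families. *)
Lemma rsum_pair I J (f : I * J -> R) : abs_summable f ->
  rsum f = rsum (fun i => rsum (fun j => f (i, j))).
Proof.
move=> sf; have sn := abs_summable_norm sf.
have sp : abs_summable (fun k => `|f k| + f k) by exact: abs_summableD.
have lp : (esumr (fun k => `|f k| + f k)%R < +oo)%E.
  by rewrite ltey_eq (esumr_fin (fun k => absD_ge0 (f k)) sp).
have [p1 p2 p3] := esumr_pair_fine (fun k => absD_ge0 (f k)) lp.
have [n1 n2 n3] := esumr_pair_fine (fun k => normr_ge0 (f k)) sf.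
rewrite (@rsum_pq _ (fun i => rsum _) _ _ _ _ p2 n2).
- by rewrite -p3 -n3.
- by move=> i; apply/fine_ge0/esumr_ge0 => j; exact: absD_ge0.
- by move=> i; apply/fine_ge0/esumr_ge0.
- by [].
Qed.

Lemma esumr_swap I J (p : I * J -> R) :
  esumr (fun k : J * I => p (k.2, k.1)) = esumr p.
Proof.
rewrite /esumr [RHS](@reindex_esum _ _ _ [set: J * I] _ (fun k => (k.2, k.1)))//.
split=> [//|[i j] [i' j'] _ _ /= [-> ->]//|[i j] _].
by exists (j, i).
Qed.

Lemma rsum_swap I J (f : I * J -> R) :
  rsum (fun k : J * I => f (k.2, k.1)) = rsum f.
Proof.
rewrite /rsum (esumr_swap (fun k => `|f k| + f k)).
by rewrite (esumr_swap (fun k => `|f k|)).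
Qed.

End RealSums.

(** * Power series in several variables *)

Section PowerSeries.
Variable R : realType.
Implicit Types (n m : nat) (r M N : R).

(* Multi-indices. *)
Notation mindex n := {ffun 'I_n -> nat}.

Lemma normr_le_rV n (x : 'rV[R]_n) (r : R) : 0 <= r ->
  (forall j, `|x 0 j| <= r) -> `|x| <= r.
Proof.
move=> r0 xr; rewrite [leLHS]/Num.norm /= mx_normrE.
by apply/bigmax_leP; split => // -[i j] _ /=; rewrite ord1.
Qed.

Lemma normr_coord_le n (x : 'rV[R]_n) j : `|x 0 j| <= `|x|.
Proof.
rewrite [leRHS]/Num.norm /= mx_normrE.
by apply: (le_bigmax _ (fun ij : 'I_1 * 'I_n => `|x ij.1 ij.2|) (0, j)).
Qed.

Lemma monomial_ge0 n (al : mindex n) (r : R) : 0 <= r ->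
  0 <= monomial al (const_mx r).
Proof. by move=> r0; apply: prodr_ge0 => i _; rewrite mxE exprn_ge0. Qed.

Lemma monomial_gt0 n (al : mindex n) (r : R) : 0 < r ->
  0 < monomial al (const_mx r).
Proof. by move=> r0; apply: prodr_gt0 => i _; rewrite mxE exprn_gt0. Qed.

Lemma norm_monomial_le n (al : mindex n) (x : 'rV[R]_n) (r : R) : `|x| <= r ->
  `|monomial al x| <= monomial al (const_mx r).
Proof.
move=> xr; rewrite normr_prod; apply: ler_prod => i _.
by rewrite normr_ge0/= mxE normrX lerXn2r ?nnegrE//
  ?(le_trans _ xr)// ?(le_trans (normr_coord_le x i)).
Qed.

Lemma monomialD n (al be : mindex n) (x : 'rV[R]_n) :
  monomial [ffun i => (al i + be i)%N] x = monomial al x * monomial be x.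
Proof.
by rewrite -big_split; apply: eq_bigr => i _ /=; rewrite ffunE exprD.
Qed.

(** [is_ps r F M]: on the closed ball of radius [r] around the origin, [F] is
    the sum of a power series with coefficients [c] such that
    [\sum |c_al| r ^ |al| <= M]. *)
Definition is_ps n (r : R) (F : 'rV[R]_n -> R) (M : R) : Prop :=
  exists c : mindex n -> R,
    (esumr (fun al => `|c al| * monomial al (const_mx r))%R <= M%:E)%E /\
    forall x, `|x| <= r -> F x = rsum (fun al => c al * monomial al x).

Lemma summable_monomials n (I : choiceType) (c : I -> R) (k : I -> mindex n)
    (x : 'rV[R]_n) (r M : R) : `|x| <= r ->
  (esumr (fun i => `|c i| * monomial (k i) (const_mx r))%R <= M%:E)%E ->
  abs_summable (fun i => c i * monomial (k i) x).
Proof.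
move=> xr cM; apply: le_lt_trans (ltry M); apply: le_trans cM.
by apply: le_esumr => i; rewrite normrM ler_wpM2l// norm_monomial_le.
Qed.

Lemma is_ps_bound n r (F : 'rV[R]_n -> R) M x : is_ps r F M -> `|x| <= r ->
  `|F x| <= M.
Proof.
move=> [c [cM cF]] xr; rewrite cF//.
have sc := summable_monomials xr cM.
apply: le_trans (ler_norm_rsum sc) _; rewrite -lee_fin fineK; last first.
  by apply: esumr_fin => //; exact: abs_summable_norm.
apply: le_trans cM; apply: le_esumr => al.
by rewrite normrM ler_wpM2l// norm_monomial_le.
Qed.

Lemma is_ps_ge0 n r (F : 'rV[R]_n -> R) M : 0 <= r -> is_ps r F M -> 0 <= M.
Proof.
by move=> r0 /(@is_ps_bound _ _ _ _ 0); rewrite normr0 => /(_ r0); apply: le_trans.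
Qed.

Lemma is_ps_ext n r (F G : 'rV[R]_n -> R) M :
  (forall x, `|x| <= r -> F x = G x) -> is_ps r F M -> is_ps r G M.
Proof. by move=> FG [c [cM cF]]; exists c; split=> // x xr; rewrite -FG// cF. Qed.

Lemma is_ps_le n r r' (F : 'rV[R]_n -> R) M M' : 0 <= r' -> r' <= r -> M <= M' ->
  is_ps r F M -> is_ps r' F M'.
Proof.
move=> r'0 r'r MM' [c [cM cF]]; exists c; split; last first.
  by move=> x xr; rewrite cF// (le_trans xr).
apply: (@le_trans _ _ M%:E); last by rewrite lee_fin.
apply: le_trans cM; apply: le_esumr => al; rewrite ler_wpM2l//.
apply: ler_prod => i _; rewrite !mxE exprn_ge0//=.
by rewrite lerXn2r ?nnegrE// (le_trans r'0).
Qed.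

(** A summable family of terms in which a monomial may occur several times is
    still a power series: terms with the same exponent are collected. *)
Lemma is_ps_family n (I : choiceType) (c : I -> R) (k : I -> mindex n) r
    (F : 'rV[R]_n -> R) M : 0 < r ->
  (esumr (fun i => `|c i| * monomial (k i) (const_mx r))%R <= M%:E)%E ->
  (forall x, `|x| <= r -> F x = rsum (fun i => c i * monomial (k i) x)) ->
  is_ps r F M.
Proof.
move=> r0 cM cF.
(* Double families indexed by an exponent [g] and a term [i], supported on the
   pairs with [k i = g]; the result compares their two iterated sums. *)
pose p (u : mindex n * I) : R :=
  if k u.2 == u.1 then `|c u.2| * monomial (k u.2) (const_mx r) else 0.
pose f x (u : mindex n * I) : R :=
  if k u.2 == u.1 then c u.2 * monomial (k u.2) x else 0.
have p0 u : 0 <= p u.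
  by rewrite /p; case: ifP => // _; rewrite mulr_ge0// monomial_ge0// ltW.
have pE : esumr p = esumr (fun i => `|c i| * monomial (k i) (const_mx r)).
  rewrite -esumr_swap esumr_pair; last by move=> u; exact: p0.
  apply: eq_esum => i _; rewrite /p /=.
  rewrite -[X in X%:E](rsum1 (k i)) rsum_nng; last exact: abs_summable1.
    rewrite fineK; last first.
      apply: esumr_fin; last exact: abs_summable1.
      by move=> j; case: ifP => // _; rewrite mulr_ge0// monomial_ge0// ltW.
    by apply: eq_esumr => j; rewrite eq_sym.
  by move=> j; case: ifP => // _; rewrite mulr_ge0// monomial_ge0// ltW.
have fp x u : `|x| <= r -> `|f x u| <= p u.
  move=> xr; rewrite /f /p; case: ifP => _; last by rewrite normr0.
  by rewrite normrM ler_wpM2l// norm_monomial_le.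
have sp : abs_summable p.
  by apply: abs_summable_nng => //; rewrite pE (le_lt_trans cM)// ltry.
have sf x : `|x| <= r -> abs_summable (f x).
  by move=> xr; apply: abs_summable_le sp => u; rewrite (ger0_norm (p0 u)) fp.
have rr : `|const_mx r : 'rV[R]_n| <= r.
  by apply: normr_le_rV => [|j]; rewrite ?mxE ?ger0_norm// ltW.
(* the coefficient of the monomial [g] after collecting terms *)
pose d (g : mindex n) : R := rsum (fun i => if k i == g then c i else 0).
(* [c] is summable over the terms of exponent [g], as [monomial g] does not
   vanish at [(r, ..., r)] *)
have dE g x : d g * monomial g x = rsum (fun i => f x (g, i)).
  have sd : abs_summable (fun i => if k i == g then c i else 0).
    have := (abs_summable_pair (sf _ rr)).1 g.
    move/(abs_summableZ (monomial g (const_mx r))^-1).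
    apply: abs_summable_le => i; rewrite /f /=.
    case: eqP => [->|_]; last by rewrite normr0.
    by rewrite mulrCA mulVf ?mulr1// gt_eqF// monomial_gt0.
  rewrite mulrC -rsumZ//; apply: eq_rsum => i; rewrite /f /=.
  by case: eqP => [->|_]; rewrite ?mulr0// mulrC.
exists d; split.
  apply: le_trans cM; rewrite -pE esumr_pair//; apply: le_esum => g _.
  rewrite -(ger0_norm (monomial_ge0 g (ltW r0))) -normrM dE.
  have sg := (abs_summable_pair (sf _ rr)).1 g.
  apply: (@le_trans _ _ (fine (esumr (fun i => `|f (const_mx r) (g, i)|)))%:E).
    by rewrite lee_fin ler_norm_rsum.
  rewrite fineK; last by apply: esumr_fin => //; exact: abs_summable_norm.
  by apply: le_esumr => i; rewrite fp.
move=> x xr; rewrite cF//.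
under [RHS]eq_rsum do rewrite dE.
rewrite -rsum_pair; last exact: sf.
rewrite -rsum_swap rsum_pair; last first.
  rewrite /abs_summable (esumr_swap (fun u => `|f x u|)).
  exact: sf.
apply: eq_rsum => i; rewrite /f /= -[LHS](rsum1 (k i)).
by apply: eq_rsum => j; rewrite eq_sym.
Qed.

(** Families of power series with summable majorants can be summed. *)
Lemma is_ps_sum n (K : choiceType) (F : K -> 'rV[R]_n -> R) (M : K -> R) r
    (G : 'rV[R]_n -> R) (N : R) : 0 < r ->
  (forall k, is_ps r (F k) (M k)) -> (esumr M <= N%:E)%E ->
  (forall x, `|x| <= r -> G x = rsum (fun k => F k x)) ->
  is_ps r G N.
Proof.
move=> r0 psF MN GE.
have /choice[c cP] := psF.
have cN : (esumr (fun u : K * mindex n =>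
    `|c u.1 u.2| * monomial u.2 (const_mx r))%R <= N%:E)%E.
  rewrite esumr_pair; last by move=> u; rewrite mulr_ge0// monomial_ge0// ltW.
  by apply: le_trans MN; apply: le_esum => k _; exact: (cP k).1.
apply: (is_ps_family r0 cN) => x xr; rewrite GE// rsum_pair; last first.
  exact: (summable_monomials xr cN).
by apply: eq_rsum => k; rewrite (cP k).2.
Qed.

Lemma is_psM n r (F G : 'rV[R]_n -> R) M N : 0 < r ->
  is_ps r F M -> is_ps r G N -> is_ps r (fun x => F x * G x) (M * N).
Proof.
move=> r0 psF psG; have M0 := is_ps_ge0 (ltW r0) psF.
have N0 := is_ps_ge0 (ltW r0) psG.
case: psF psG => [c [cM cF]] [d [dN dG]].
have mr0 al := @monomial_ge0 n al r (ltW r0).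
have cdMN : (esumr (fun u : mindex n * mindex n => `|c u.1 * d u.2| *
    monomial [ffun i => (u.1 i + u.2 i)%N] (const_mx r))%R <= (M * N)%:E)%E.
  rewrite esumr_pair; last by move=> u; rewrite mulr_ge0// monomial_ge0// ltW.
  apply: (@le_trans _ _ (esumr (fun al => N * (`|c al| * monomial al (const_mx r))))).
    apply: le_esum => al _.
    apply: (@le_trans _ _ (esumr (fun be => (`|c al| * monomial al (const_mx r)) *
       (`|d be| * monomial be (const_mx r))))).
      by apply: le_esumr => be /=; rewrite monomialD normrM mulrACA.
    apply: le_trans (le_esumrZ _ _) _; try by move=> *; rewrite mulr_ge0// mr0.
    by rewrite [N * _]mulrC [(_ * N)%:E]EFinM lee_wpmul2l// lee_fin mulr_ge0// mr0.
  apply: le_trans (le_esumrZ _ _) _ => //; first by move=> *; rewrite mulr_ge0// mr0.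
  by rewrite [M * N]mulrC EFinM lee_wpmul2l// lee_fin.
apply: (is_ps_family r0 cdMN) => x xr; rewrite rsum_pair; last first.
  exact: (summable_monomials xr cdMN).
rewrite cF// mulrC -rsumZ; last exact: (summable_monomials (k := id) xr cM).
apply: eq_rsum => al; rewrite mulrC dG// -rsumZ; last first.
  exact: (summable_monomials (k := id) xr dN).
by apply: eq_rsum => be /=; rewrite monomialD mulrACA.
Qed.

Lemma is_psD n r (F G : 'rV[R]_n -> R) M N : 0 < r ->
  is_ps r F M -> is_ps r G N -> is_ps r (fun x => F x + G x) (M + N).
Proof.
move=> r0 [c [cM cF]] [d [dN dG]]; exists (fun al => c al + d al); split.
  have mr0 al := @monomial_ge0 n al r (ltW r0).
  apply: (@le_trans _ _ (esumr (fun al => `|c al| * monomial al (const_mx r) +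
     `|d al| * monomial al (const_mx r)))).
    by apply: le_esumr => al; rewrite -mulrDl ler_wpM2r// ler_normD.
  by rewrite esumrD ?EFinD ?leeD// => al; rewrite mulr_ge0// mr0.
move=> x xr; rewrite cF// dG// -rsumD.
- by apply: eq_rsum => al; rewrite mulrDl.
- exact: (summable_monomials (k := id) xr cM).
- exact: (summable_monomials (k := id) xr dN).
Qed.

Lemma is_ps_monomial n r (a : R) (al0 : mindex n) : 0 < r ->
  is_ps r (fun x => a * monomial al0 x) (`|a| * monomial al0 (const_mx r)).
Proof.
move=> r0; apply: (@is_ps_family _ unit (fun=> a) (fun=> al0)) => //.
  rewrite /esumr (_ : [set: unit] = [set tt]).
    by rewrite esum_set1// lee_fin mulr_ge0// monomial_ge0// ltW.
  by apply/seteqP; split => -[].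
move=> x xr; rewrite -[LHS](rsum1 tt).
by apply: eq_rsum => -[]; rewrite eqxx.
Qed.

Lemma is_ps_cst n r (a : R) : 0 < r -> is_ps r (fun=> a : R) `|a| (n := n).
Proof.
move=> r0; have := @is_ps_monomial n r a [ffun=> 0%N] r0.
rewrite [monomial _ _]big1 ?mulr1; last by move=> i _; rewrite ffunE expr0.
apply: is_ps_ext => x _; rewrite [monomial _ _]big1 ?mulr1// => i _.
by rewrite ffunE expr0.
Qed.

Lemma is_ps_coord n r (j : 'I_n) : 0 < r -> is_ps r (fun x => x 0 j) r.
Proof.
move=> r0; have := @is_ps_monomial n r 1 [ffun i => (i == j) : nat] r0.
have mE x : monomial [ffun i => (i == j) : nat] x = x 0 j :> R.
  rewrite /monomial (bigD1 j)//= ffunE eqxx expr1 big1 ?mulr1// => i /negPf ij.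
  by rewrite ffunE ij expr0.
by rewrite mE mxE normr1 mul1r; apply: is_ps_ext => x _; rewrite mE mul1r.
Qed.

Lemma is_ps_prod n (I : Type) (s : seq I) r (F : I -> 'rV[R]_n -> R)
    (M : I -> R) : 0 < r -> (forall i, is_ps r (F i) (M i)) ->
  is_ps r (fun x => \prod_(i <- s) F i x) (\prod_(i <- s) M i).
Proof.
move=> r0 psF; elim: s => [|i s IH].
  rewrite big_nil; have := @is_ps_cst n r 1 r0; rewrite normr1.
  by apply: is_ps_ext => x _; rewrite big_nil.
rewrite big_cons; apply: is_ps_ext (is_psM r0 (psF i) IH) => x _.
by rewrite big_cons.
Qed.

Lemma is_psX n r (F : 'rV[R]_n -> R) M k : 0 < r -> is_ps r F M ->
  is_ps r (fun x => F x ^+ k) (M ^+ k).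
Proof.
move=> r0 psF; have :=
  @is_ps_prod n nat (index_iota 0 k) r (fun=> F) (fun=> M) r0 (fun=> psF).
rewrite prodr_const_nat subn0.
by apply: is_ps_ext => x _; rewrite prodr_const_nat subn0.
Qed.

(** Substitution of power series into a power series: if each component of
    [G] has majorant [rho], a majorant of [F] on the ball of radius [rho] is one
    of the composite. *)
Lemma is_ps_comp n m r rho (F : 'rV[R]_m -> R) (G : 'rV[R]_n -> 'rV[R]_m) M :
  0 < r -> 0 <= rho -> is_ps rho F M ->
  (forall j, is_ps r (fun x => G x 0 j) rho) ->
  is_ps r (fun x => F (G x)) M.
Proof.
move=> r0 rho0 [c [cM cF]] psG.
apply: (@is_ps_sum n (mindex m) (fun al x => c al * monomial al (G x))
  (fun al => `|c al| * monomial al (const_mx rho))) => //.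
  move=> al; apply: is_psM => //; first exact: is_ps_cst.
  apply: (@is_ps_prod n _ _ r (fun i x => G x 0 i ^+ al i)
    (fun i => const_mx rho 0 i ^+ al i)) => // i.
  by apply: is_psX => //; rewrite mxE.
by move=> x xr; apply: cF; apply: normr_le_rV => // j; exact: is_ps_bound (psG j) xr.
Qed.

(** Once its constant term is removed, a power series has an arbitrarily small
    majorant on small balls. *)
Lemma is_ps_small n r0 (g : 'rV[R]_n -> R) M0 (rho : R) : 0 < r0 -> 0 < rho ->
  is_ps r0 g M0 ->
  exists r, [/\ 0 < r, r <= r0 &
    forall s, 0 < s -> s <= r -> is_ps s (fun x => g x - g 0) rho].
Proof.
move=> r00 rho0 psg; have M00 := is_ps_ge0 (ltW r00) psg.
case: psg => [c [cM cg]].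
(* chosen so that [r / r0 * M0 <= rho] *)
pose r := Num.min r0 (r0 * rho / (M0 + 1)).
have M1 : 0 < M0 + 1 by lra.
have rr : r * M0 <= r0 * rho.
  apply: (@le_trans _ _ ((r0 * rho / (M0 + 1)) * (M0 + 1))); last first.
    by rewrite divfK// gt_eqF.
  apply: ler_pM => //; rewrite ?ge_min ?lexx ?orbT//; last lra.
  by rewrite le_min !divr_ge0 ?mulr_ge0 ?ltW.
have r_gt0 : 0 < r by rewrite lt_min r00 divr_gt0// mulr_gt0.
exists r; split => //; first by rewrite ge_min lexx.
move=> s s0 sr; have sr0 : s <= r0 by rewrite (le_trans sr)// ge_min lexx.
pose z : mindex n := [ffun=> 0%N].
have mz x : monomial z x = 1 :> R.
  by rewrite /monomial big1// => i _; rewrite ffunE expr0.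
pose d al : R := if al == z then 0 else c al.
(* a monomial of positive degree gains a factor s / r0 *)
have ms al : al != z ->
    monomial al (const_mx s) <= s / r0 * monomial al (const_mx r0) :> R.
  move=> alz; have [j aj] : exists j, al j != 0%N.
    apply/existsP; apply: contraR alz; rewrite negb_exists => /forallP al0.
    by apply/eqP/ffunP => j; rewrite ffunE; apply/eqP; have := al0 j; rewrite negbK.
  rewrite /monomial (bigD1 j)//= [in leRHS](bigD1 j)//= !mxE mulrA.
  apply: ler_pM; rewrite ?exprn_ge0 ?(ltW s0)//.
  - by apply: prodr_ge0 => i _; rewrite mxE exprn_ge0// ltW.
  - case: (al j) aj => // k _; rewrite exprS exprS mulrA divfK ?gt_eqF//.
    by rewrite ler_wpM2l ?(ltW s0)// lerXn2r ?nnegrE ?(ltW s0) ?(ltW r00).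
  - apply: ler_prod => i _; rewrite !mxE exprn_ge0 ?(ltW s0)//=.
    by rewrite lerXn2r ?nnegrE ?(ltW s0) ?(ltW r00).
have mr0 al := @monomial_ge0 n al r0 (ltW r00).
exists d; split.
  apply: (@le_trans _ _ (esumr (fun al =>
      (s / r0) * (`|c al| * monomial al (const_mx r0))))).
    apply: le_esumr => al; rewrite /d; case: eqVneq => [_|alz].
      by rewrite normr0 mul0r !mulr_ge0 ?invr_ge0// ltW.
    by rewrite mulrCA ler_wpM2l// ms.
  apply: le_trans (le_esumrZ _ _) _; first by rewrite divr_ge0// ltW.
    by move=> al; rewrite mulr_ge0// mr0.
  apply: (@le_trans _ _ ((s / r0)%:E * M0%:E)%E).
    by rewrite lee_wpmul2l// lee_fin divr_ge0// ltW.
  rewrite -EFinM lee_fin mulrAC ler_pdivrMr// [rho * _]mulrC.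
  by apply: le_trans rr; rewrite ler_wpM2r.
move=> x xs; have xr : `|x| <= r0 by rewrite (le_trans xs).
have sc y : `|y| <= r0 -> abs_summable (fun al => c al * monomial al y).
  by move=> yr; exact: (summable_monomials (k := id) yr cM).
have g0 : g 0 = c z.
  rewrite cg ?normr0 ?ltW// -[RHS](rsum1 z); apply: eq_rsum => al.
  case: eqVneq => [->|alz]; first by rewrite mz mulr1.
  have [j aj] : exists j, al j != 0%N.
    apply/existsP; apply: contraR alz; rewrite negb_exists => /forallP al0.
    by apply/eqP/ffunP => j; rewrite ffunE; apply/eqP; have := al0 j; rewrite negbK.
  by rewrite /monomial (bigD1 j)//= mxE expr0n (negPf aj) mul0r mulr0.
rewrite g0 cg// -[in LHS](rsum1 z (c z)) -rsumN; last exact: abs_summable1.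
rewrite -rsumD; [|exact: sc|]; last first.
  have := abs_summableZ (-1) (abs_summable1 z (c z)).
  by apply: abs_summable_le => al; rewrite mulN1r.
apply: eq_rsum => al; rewrite /d; case: eqVneq => [->|_].
  by rewrite mz mulr1 subrr mul0r.
by rewrite subr0.
Qed.

End PowerSeries.

(** * Real analytic functions and power series expansions *)

Section Analytic.
Variable R : realType.
Implicit Types (n m : nat).

Notation mindex n := {ffun 'I_n -> nat}.

(** The partial sum over a cube of multi-indices, as an unordered sum. *)
Lemma cube_sum n (N : nat) (p : mindex n -> R) : (forall al, 0 <= p al) ->
  (\sum_(al : {ffun 'I_n -> 'I_N}) p [ffun i => val (al i)])%:E =
  esum [set al : mindex n | forall i, (al i < N)%N] (fun al => (p al)%:E).
Proof.
move=> p0; pose e (al : {ffun 'I_n -> 'I_N}) : mindex n := [ffun i => val (al i)].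
rewrite (@reindex_esum _ _ _ [set: {ffun 'I_n -> 'I_N}] _ e).
  rewrite esum_fset; [|exact: finite_finset|by move=> i _; rewrite lee_fin].
  rewrite fsbig_finite; last exact: finite_finset.
  rewrite [RHS]big_uniq ?finmap.fset_uniq//= -sumEFin.
  apply: eq_bigl => al; rewrite in_fset_set ?inE; last exact: finite_finset.
  by rewrite mem_setT.
split.
- by move=> al _ i; rewrite /e ffunE /=.
- move=> al be _ _ /ffunP ab; apply/ffunP => i; apply: val_inj.
  by have := ab i; rewrite !ffunE.
- move=> al /= alN; exists [ffun i => Ordinal (alN i)] => //.
  by apply/ffunP => i; rewrite !ffunE.
Qed.

Lemma cube_lim_nng n (p : mindex n -> R) : (forall al, 0 <= p al) ->
  abs_summable p ->
  (fun N => \sum_(al : {ffun 'I_n -> 'I_N}) p [ffun i => val (al i)])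
    @ \oo --> rsum p.
Proof.
move=> p0 sp; have fp : esumr p \is a fin_num by exact: esumr_fin.
have cube_le N :
    \sum_(al : {ffun 'I_n -> 'I_N}) p [ffun i => val (al i)] <= rsum p.
  rewrite rsum_nng// -lee_fin fineK// cube_sum//.
  by apply: ereal_sup_le => _ [F [finF FN] <-]; exists F.
apply/cvgrPdist_le => e e0.
have : ((rsum p - e)%:E < esumr p)%E.
  by rewrite -(fineK fp) -rsum_nng// lte_fin; lra.
move=> /ereal_sup_gt[_ [F [finF _] <-] eF].
(* exceeds every entry of every multi-index in [F] *)
pose B : nat := (\sum_(al <- finmap.enum_fset (fset_set F)) \sum_i al i).+1%N.
exists B => // N /= BN.
rewrite ger0_norm ?subr_ge0 ?cube_le// lerBlDr -lerBlDl -lee_fin cube_sum//.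
apply: le_trans (ltW eF) _; apply: ereal_sup_ubound; exists F => //.
split=> // al Fal i; apply: leq_trans BN; rewrite ltnS.
rewrite (big_rem al)/= ?in_fset_set ?inE//.
by rewrite (bigD1 i)//= -addnA leq_addr.
Qed.

Lemma cube_lim n (f : mindex n -> R) : abs_summable f ->
  (fun N => \sum_(al : {ffun 'I_n -> 'I_N}) f [ffun i => val (al i)])
    @ \oo --> rsum f.
Proof.
move=> sf; have sn := abs_summable_norm sf.
have sp : abs_summable (fun i => `|f i| + f i) by exact: abs_summableD.
have -> : rsum f = rsum (fun i => `|f i| + f i) - rsum (fun i => `|f i|).
  by rewrite rsumD//; ring.
have -> : (fun N => \sum_(al : {ffun 'I_n -> 'I_N}) f [ffun i => val (al i)]) =
  (fun N => \sum_(al : {ffun 'I_n -> 'I_N}) (`|f [ffun i => val (al i)]| +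
       f [ffun i => val (al i)])) -
  (fun N => \sum_(al : {ffun 'I_n -> 'I_N}) `|f [ffun i => val (al i)]|).
  by apply/funext => N /=; rewrite -[RHS]sumrB; apply: eq_bigr => al _; ring.
apply: cvgB; last exact: (cube_lim_nng (fun al => normr_ge0 (f al))).
exact: (cube_lim_nng (fun al => absD_ge0 (f al))).
Qed.

Lemma analytic_atP n (f : 'rV[R]_n -> R) (a : 'rV[R]_n) :
  analytic_at f a <->
  exists2 r, 0 < r & exists M, is_ps r (fun h => f (a + h)) M.
Proof.
split=> [[c]|[r r0 [M [c [cM cf]]]]].
  rewrite -nbhs_nearE => /nbhs_normP[e /= e0 ec].
  have e20 : 0 < e / 2 by rewrite divr_gt0.
  have He h : `|h| <= e / 2 -> power_series_sum c h (f (a + h)).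
    move=> he; have := ec (a + h); rewrite /= [X in power_series_sum _ X]addrC.
    rewrite addrA addNr add0r; apply.
    by rewrite opprD addrA subrr add0r normrN (le_lt_trans he)//; lra.
  exists (e / 2) => //.
  have [ce _] : power_series_sum c (const_mx (e / 2)) (f (a + const_mx (e / 2))).
    by apply: He; apply: normr_le_rV => [|j]; rewrite ?mxE ?ger0_norm// ltW.
  have sc : abs_summable (fun al => c al * monomial al (const_mx (e / 2))) by [].
  have se : abs_summable (fun al => `|c al| * monomial al (const_mx (e / 2))).
    by apply: abs_summable_le sc => al; rewrite !normrM normr_id.
  have fe := esumr_fin (fun al =>
    mulr_ge0 (normr_ge0 (c al)) (monomial_ge0 al (ltW e20))) se.
  exists (fine (esumr (fun al => `|c al| * monomial al (const_mx (e / 2))))).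
  exists c; split; first by rewrite fineK.
  move=> h he; have [sh ch] := He h he.
  exact: (cvg_unique _ ch (cube_lim sh)).
exists c; apply/nbhs_normP; exists r => //= x /=; rewrite distrC => /ltW xr.
have sx := summable_monomials (k := id) xr cM.
split; first exact: sx.
by rewrite -[in f x](subrK a x) [x - a + a]addrC cf//; exact: cube_lim.
Qed.

Lemma analytic_at_small n (f : 'rV[R]_n -> R) (a : 'rV[R]_n) (rho : R) :
  0 < rho -> analytic_at f a -> exists2 r, 0 < r &
    forall s, 0 < s -> s <= r -> is_ps s (fun h => f (a + h) - f a) rho.
Proof.
move=> rho0 /analytic_atP[r r0 [M fM]].
have [s [s0 _ sP]] := is_ps_small r0 rho0 fM.
exists s => // t t0 ts; apply: is_ps_ext (sP t t0 ts) => x _.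
by rewrite addr0.
Qed.

(** A single radius serves for all the components of a map. *)
Lemma analytic_at_map_small n m (f : 'rV[R]_n -> 'rV[R]_m) (a : 'rV[R]_n)
    (rho : R) :
  0 < rho -> (forall j, analytic_at (fun x => f x 0 j) a) -> exists2 r, 0 < r &
    forall j, is_ps r (fun h => (f (a + h) - f a) 0 j) rho.
Proof.
move=> rho0 af.
have /choice[r rP] : forall j, exists r, 0 < r /\
    forall s, 0 < s -> s <= r -> is_ps s (fun h => f (a + h) 0 j - f a 0 j) rho.
  by move=> j; have [r r0 rP] := analytic_at_small rho0 (af j); exists r.
exists (\big[Num.min/1]_j r j).
  by apply: lt_bigmin => // j _; exact: (rP j).1.
move=> j; have := (rP j).2 (\big[Num.min/1]_j r j).
move=> /(_ _ _)/is_ps_ext; apply.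
- by move=> x _; rewrite !mxE.
- by apply: lt_bigmin => // i _; exact: (rP i).1.
- exact: bigmin_le_cond.
Qed.

Lemma analytic_at_continuous n m (f : 'rV[R]_n -> 'rV[R]_m) (a : 'rV[R]_n) :
  (forall j, analytic_at (fun x => f x 0 j) a) -> {for a, continuous f}.
Proof.
move=> af; apply: (proj2 (@cvgrPdist_le _ _ _ (nbhs a) _ f (f a))) => e e0.
have [r r0 rP] := analytic_at_map_small e0 af.
apply: (proj2 (nbhs_normP a _)); exists r => //= x /=; rewrite distrC => /ltW xr.
rewrite distrC; apply: normr_le_rV; first exact: ltW.
by move=> j; have /= := is_ps_bound (rP j) xr; rewrite [a + _]addrC subrK.
Qed.

Lemma analytic_at_comp n m (f : 'rV[R]_m -> R) (g : 'rV[R]_n -> 'rV[R]_m)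
    (a : 'rV[R]_n) :
  analytic_at f (g a) -> (forall j, analytic_at (fun x => g x 0 j) a) ->
  analytic_at (fun x => f (g x)) a.
Proof.
move=> /analytic_atP[rho rho0 [M fM]] ag.
have [r r0 rP] := analytic_at_map_small rho0 ag.
apply/analytic_atP; exists r => //; exists M.
apply: is_ps_ext (is_ps_comp r0 (ltW rho0) fM rP) => x _ /=.
by rewrite addrC subrK.
Qed.

Lemma analytic_at_ext n (f g : 'rV[R]_n -> R) (a : 'rV[R]_n) :
  (\forall x \near a, f x = g x) -> analytic_at f a -> analytic_at g a.
Proof.
move=> fg [c cf]; exists c; near=> x.
by rewrite -(near fg x)//; near: x.
Unshelve. all: by end_near. Qed.

Lemma analytic_at_cst n (a : 'rV[R]_n) (t : R) : analytic_at (fun=> t) a.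
Proof. by apply/analytic_atP; exists 1 => //; exists `|t|; exact: is_ps_cst. Qed.

Lemma analytic_at_coord n (a : 'rV[R]_n) j : analytic_at (fun x => x 0 j) a.
Proof.
apply/analytic_atP; exists 1 => //; exists (`|a 0 j| + 1).
have := is_psD ltr01 (is_ps_cst n (a 0 j) ltr01) (is_ps_coord j ltr01).
by apply: is_ps_ext => x _; rewrite mxE.
Qed.

Lemma analytic_atD n (f g : 'rV[R]_n -> R) (a : 'rV[R]_n) :
  analytic_at f a -> analytic_at g a -> analytic_at (fun x => f x + g x) a.
Proof.
move=> /analytic_atP[r r0 [M fM]] /analytic_atP[s s0 [N gN]].
apply/analytic_atP; exists (Num.min r s); first by rewrite lt_min r0.
have t0 : 0 < Num.min r s by rewrite lt_min r0.
exists (M + N); apply: is_psD => //.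
  by apply: is_ps_le fM; rewrite ?ge_min ?lexx ?(ltW t0).
by apply: is_ps_le gN; rewrite ?ge_min ?lexx ?orbT ?(ltW t0).
Qed.

Lemma analytic_atN n (f : 'rV[R]_n -> R) (a : 'rV[R]_n) :
  analytic_at f a -> analytic_at (fun x => - f x) a.
Proof.
move=> /analytic_atP[r r0 [M fM]]; apply/analytic_atP; exists r => //.
exists (`|-1| * M); have := is_psM r0 (is_ps_cst n (-1) r0) fM.
by apply: is_ps_ext => x _; rewrite mulN1r.
Qed.

End Analytic.

(** * Row vectors and continuity *)

Section RowVectors.
Variable R : realType.
Implicit Types n m : nat.

Lemma continuous_openI (X Y : topologicalType) (f : X -> Y) (O : set X)
    (W : set Y) : open O -> open W ->
  (forall x, O x -> {for x, continuous f}) -> open (O `&` f @^-1` W).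
Proof.
move=> oO oW cf; rewrite openE => x [Ox Wx]; apply: filterI.
  exact: open_nbhs_nbhs.
by apply: cf => //; exact: open_nbhs_nbhs.
Qed.

Lemma nbhs_row_mx n m (a : 'rV[R]_n) (b : 'rV[R]_m) (P : set 'rV[R]_(n + m)) :
  nbhs (row_mx a b) P ->
  exists2 e, 0 < e &
    forall a' b', `|a' - a| < e -> `|b' - b| < e -> P (row_mx a' b').
Proof.
move=> /nbhs_normP[e /= e0 eP]; exists (e / 2); first by rewrite divr_gt0.
move=> a' b' aa bb; apply: eP => /=; rewrite distrC.
apply: (@le_lt_trans _ _ (e / 2)); last lra.
apply: normr_le_rV => [|j]; first lra.
rewrite opp_row_mx add_row_mx; case: (split_ordP j) => i ->.
  by rewrite row_mxEl; exact: le_trans (normr_coord_le _ _) (ltW aa).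
rewrite row_mxEr; exact: le_trans (normr_coord_le _ _) (ltW bb).
Qed.

Lemma row_mx_continuous_at n m (z : 'rV[R]_n * 'rV[R]_m) :
  {for z, continuous (fun z : 'rV[R]_n * 'rV[R]_m => row_mx z.1 z.2)}.
Proof.
case: z => a b P /= /nbhs_row_mx[e e0 eP]; exists (ball a e, ball b e).
  by split; exact: nbhsx_ballx.
by move=> [a' b'] /= [aa bb]; apply: eP; rewrite distrC;
  [move: aa|move: bb]; rewrite -ball_normE.
Qed.

Lemma analytic_lsubmx n m (u : 'rV[R]_(n + m)) j :
  analytic_at (fun x : 'rV[R]_(n + m) => lsubmx x 0 j) u.
Proof.
have := analytic_at_coord u (lshift m j).
by congr (analytic_at _ u); apply/funext => x; rewrite mxE.
Qed.

Lemma analytic_rsubmx n m (u : 'rV[R]_(n + m)) j :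
  analytic_at (fun x : 'rV[R]_(n + m) => rsubmx x 0 j) u.
Proof.
have := analytic_at_coord u (rshift n j).
by congr (analytic_at _ u); apply/funext => x; rewrite mxE.
Qed.

Lemma analytic_row_mx k n m (f : 'rV[R]_k -> 'rV[R]_n) (g : 'rV[R]_k -> 'rV[R]_m)
    (u : 'rV[R]_k) :
  (forall j, analytic_at (fun x => f x 0 j) u) ->
  (forall j, analytic_at (fun x => g x 0 j) u) ->
  forall j, analytic_at (fun x => row_mx (f x) (g x) 0 j) u.
Proof.
move=> af ag j; case: (split_ordP j) => i ->.
  have := af i; congr (analytic_at _ u).
  by apply/funext => x; rewrite row_mxEl.
have := ag i; congr (analytic_at _ u).
by apply/funext => x; rewrite row_mxEr.
Qed.

Lemma lsubmx_continuous n m : continuous (lsubmx : 'rV[R]_(n + m) -> 'rV[R]_n).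
Proof. by move=> u; apply: analytic_at_continuous; exact: analytic_lsubmx. Qed.

Lemma rsubmx_continuous n m : continuous (rsubmx : 'rV[R]_(n + m) -> 'rV[R]_m).
Proof. by move=> u; apply: analytic_at_continuous; exact: analytic_rsubmx. Qed.

Lemma open_prod_rV n m (U : set 'rV[R]_n) (V : set 'rV[R]_m) :
  open U -> open V ->
  open [set z : 'rV[R]_(n + m) | U (lsubmx z) /\ V (rsubmx z)].
Proof.
move=> oU oV; rewrite -[X in open X]/((lsubmx @^-1` U) `&` (rsubmx @^-1` V)).
apply: openI; apply: open_comp => // u _.
- exact: lsubmx_continuous.
- exact: rsubmx_continuous.
Qed.

Lemma analytic_map_within n m (U : set 'rV[R]_n) (f : 'rV[R]_n -> 'rV[R]_m) :
  open U -> analytic_map U f -> {within U, continuous f}.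
Proof.
move=> oU af; rewrite continuous_open_subspace// => x /set_mem Ux.
by apply: analytic_at_continuous => j; exact: af.
Qed.

End RowVectors.

(** * Germs of semianalytic sets *)

Section Germs.
Variable R : realType.

(** [R^n] as a manifold, with the identity as its only chart. *)
Definition std_manifold n : set (mchart R n 'rV[R]_n) :=
  [set MChart [set: 'rV[R]_n] id].

(** The set [A] is semianalytic at the point [x]; a set is semianalytic when it
    is so at every point. *)
Definition semian_at n (M : topologicalType) (aM : set (mchart R n M))
    (A : set M) (x : M) : Prop :=
  exists2 U, open_nbhs x U & S_analytic aM U (A `&` U).

Lemma std_manifold_analytic n (U : set 'rV[R]_n) f :
  analytic_on U f -> manifold_analytic (@std_manifold n) U f.
Proof. by move=> af _ ->; exists f => //= a [b [Ub _] <-]; exact: af. Qed.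

Lemma std_analytic_on n (U : set 'rV[R]_n) f : open U ->
  manifold_analytic (@std_manifold n) U f -> analytic_on U f.
Proof.
move=> oU /(_ _ erefl)[g /= ag gf] a Ua.
apply: (@analytic_at_ext _ _ g); last by apply: ag; exists a.
by apply: filterS (open_nbhs_nbhs (conj oU Ua)) => x Ux; exact: gf.
Qed.

Lemma manifold_analyticS n (M : topologicalType) (aM : set (mchart R n M))
    (U V : set M) f :
  V `<=` U -> manifold_analytic aM U f -> manifold_analytic aM V f.
Proof.
move=> VU af c ac; have [g ag gf] := af c ac; exists g.
  by move=> _ [x [Vx cx] <-]; apply: ag; exists x => //; split => //; exact: VU.
by move=> x Vx; apply: gf; exact: VU.
Qed.

(** The family S(C^omega(W)) is pulled back along any map along which real
    analytic functions are pulled back. *)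
Lemma S_analytic_pull n m (M N : topologicalType) (aM : set (mchart R n M))
    (aN : set (mchart R m N)) (T : M -> N) (U : set M) (W A : set N) :
  (forall x, U x -> W (T x)) ->
  (forall f, manifold_analytic aN W f -> manifold_analytic aM U (f \o T)) ->
  S_analytic aN W A -> S_analytic aM U (U `&` T @^-1` A).
Proof.
move=> UW pf; elim=> [f /pf fT|B C _ IB _ IC|B C _ IB _ IC|B _ IB].
- rewrite [X in S_analytic _ _ X](_ : _ = [set x | U x /\ 0 < (f \o T) x]).
    exact: S_analytic_pos.
  by apply/seteqP; split=> x /= [Ux]; [case|split => //; split => //; exact: UW].
- rewrite [X in S_analytic _ _ X](_ : _ = (U `&` T @^-1` B) `&` (U `&` T @^-1` C)).
    exact: S_analytic_setI.
  by rewrite preimage_setI setIACA setIid.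
- by rewrite preimage_setU setIUr; exact: S_analytic_setU.
- rewrite [X in S_analytic _ _ X](_ : _ = U `\` (U `&` T @^-1` B)).
    exact: S_analytic_setD.
  apply/seteqP; split=> x /=; first by move=> [Ux [_ nB]]; split=> // -[].
  by move=> [Ux nB]; split=> //; split; [exact: UW|move=> ?; exact: nB].
Qed.

Lemma semian_at_pull n m (M N : topologicalType) (aM : set (mchart R n M))
    (aN : set (mchart R m N)) (T : M -> N) (O : set M) (A : set N) x :
  open O -> O x -> (forall y, O y -> {for y, continuous T}) ->
  (forall W f, open W -> manifold_analytic aN W f ->
     manifold_analytic aM (O `&` T @^-1` W) (f \o T)) ->
  semian_at aN A (T x) -> semian_at aM (T @^-1` A) x.
Proof.
move=> oO Ox cT pf [W [oW Wx] SA]; exists (O `&` T @^-1` W).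
  by split; [exact: continuous_openI|].
rewrite [X in S_analytic _ _ X](_ : _ = O `&` T @^-1` W `&` T @^-1` (A `&` W)).
  by apply: (@S_analytic_pull _ _ _ _ _ aN T _ W) => // [y []//|f]; exact: pf.
by apply/seteqP; split=> y /= [] => [Ay [Oy Wy]|[Oy Wy] [Ay _]].
Qed.

Section Manifold.
Variables (n : nat) (M : topologicalType) (aM : set (mchart R n M)).

Lemma semian_at_near (A B : set M) x :
  nbhs x [set y | A y <-> B y] -> semian_at aM A x -> semian_at aM B x.
Proof.
rewrite nbhsE => -[V [oV Vx] VAB] [U [oU Ux] SA].
exists (V `&` U); first by split; [exact: openI|].
rewrite [X in S_analytic _ _ X](_ : _ = V `&` U `&` id @^-1` (A `&` U)).
  apply: (@S_analytic_pull _ _ _ _ _ aM id _ U) => // [y []//|f].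
  by apply: manifold_analyticS => y [].
apply/seteqP; split=> y /= [] => [By [Vy Uy]|[Vy Uy] [Ay _]].
  by split => //; split => //; exact/VAB.
by split => //; exact/VAB.
Qed.

Lemma semian_at_empty (A : set M) x : nbhs x (~` A) -> semian_at aM A x.
Proof.
move=> nA; apply: (@semian_at_near set0).
  by apply: filterS nA => y /= nAy; split.
exists setT; first by split; [exact: openT|].
rewrite set0I -(setDv [set: M]); apply: S_analytic_setD.
rewrite [X in S_analytic _ _ X](_ : _ = [set x | [set: M] x /\ 0 < (cst (1 : R)) x]).
  apply: S_analytic_pos => c _; exists (fun=> 1) => // a _.
  exact: analytic_at_cst.
by apply/seteqP; split=> y //= _; split => //; exact: ltr01.
Qed.

Lemma semian_atI (A B : set M) x :
  semian_at aM A x -> semian_at aM B x -> semian_at aM (A `&` B) x.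
Proof.
move=> [U [oU Ux] SA] [V [oV Vx] SB]; exists (U `&` V).
  by split; [exact: openI|].
have S1 : S_analytic aM (U `&` V) (U `&` V `&` id @^-1` (A `&` U)).
  apply: (@S_analytic_pull _ _ _ _ _ aM id _ U) => // [y []//|f].
  by apply: manifold_analyticS => y [].
have S2 : S_analytic aM (U `&` V) (U `&` V `&` id @^-1` (B `&` V)).
  apply: (@S_analytic_pull _ _ _ _ _ aM id _ V) => // [y []//|f].
  by apply: manifold_analyticS => y [].
rewrite [X in S_analytic _ _ X](_ : _ =
  (U `&` V `&` (A `&` U)) `&` (U `&` V `&` (B `&` V))).
  exact: S_analytic_setI S1 S2.
by apply/seteqP; split=> y /=; [case=> -[? ?] [? ?]|case=> -[[? ?] [? ?]] [_ []]].
Qed.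

Lemma semian_atU (A B : set M) x :
  semian_at aM A x -> semian_at aM B x -> semian_at aM (A `|` B) x.
Proof.
move=> [U [oU Ux] SA] [V [oV Vx] SB]; exists (U `&` V).
  by split; [exact: openI|].
have S1 : S_analytic aM (U `&` V) (U `&` V `&` id @^-1` (A `&` U)).
  apply: (@S_analytic_pull _ _ _ _ _ aM id _ U) => // [y []//|f].
  by apply: manifold_analyticS => y [].
have S2 : S_analytic aM (U `&` V) (U `&` V `&` id @^-1` (B `&` V)).
  apply: (@S_analytic_pull _ _ _ _ _ aM id _ V) => // [y []//|f].
  by apply: manifold_analyticS => y [].
rewrite [X in S_analytic _ _ X](_ : _ =
  (U `&` V `&` (A `&` U)) `|` (U `&` V `&` (B `&` V))).
  exact: S_analytic_setU S1 S2.
apply/seteqP; split=> y /=.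
  by case=> -[?|?] [? ?]; [left|right].
by case=> -[[? ?] [? _]]; split => //; [left|right].
Qed.

Lemma semian_at_bigU (I : eqType) (s : seq I) (A : I -> set M) x :
  (forall i, i \in s -> semian_at aM (A i) x) ->
  semian_at aM [set y | exists2 i, i \in s & A i y] x.
Proof.
elim: s => [|i s IH] sA.
  by apply: semian_at_empty; apply: filterS filterT => y _ [].
apply: (@semian_at_near (A i `|` [set y | exists2 i, i \in s & A i y])).
  apply: filterS filterT => y _; split=> [[Ay|[j js Ay]]|[j]].
  - by exists i => //; rewrite mem_head.
  - by exists j => //; rewrite inE js orbT.
  - by rewrite inE => /predU1P[->|js] Ay; [left|right; exists j].
apply: semian_atU; first by apply: sA; rewrite mem_head.
by apply: IH => j js; apply: sA; rewrite inE js orbT.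
Qed.

Lemma semian_at_bigI (I : eqType) (s : seq I) (A : I -> set M) x :
  (forall i, i \in s -> semian_at aM (A i) x) ->
  semian_at aM [set y | forall i, i \in s -> A i y] x.
Proof.
elim: s => [|i s IH] sA.
  apply: (@semian_at_near (~` set0)).
    by apply: filterS filterT => y _; split=> [_ j|_ []]; rewrite ?in_nil.
  have [|U oU] := @semian_at_empty set0 x; first by rewrite setC0; exact: filterT.
  rewrite set0I => S0; exists U => //.
  rewrite (_ : ~` set0 `&` U = U `\` set0); first exact: S_analytic_setD.
  by rewrite setDE setIC.
apply: (@semian_at_near (A i `&` [set y | forall i, i \in s -> A i y])).
  apply: filterS filterT => y _; split=> [[Ay sAy] j|sAy].
    by rewrite inE => /predU1P[->//|]; exact: sAy.
  split=> [|j js]; first by apply: sAy; rewrite mem_head.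
  by apply: sAy; rewrite inE js orbT.
apply: semian_atI; first by apply: sA; rewrite mem_head.
by apply: IH => j js; apply: sA; rewrite inE js orbT.
Qed.

(** From a manifold to [R^n], along a chart [e] with local inverse [T]. *)
Lemma semian_at_chart (e : mchart R n M) (T : 'rV[R]_n -> M)
    (O : set 'rV[R]_n) (A : set M) u :
  aM e -> open O -> O u ->
  (forall v, O v -> [/\ {for v, continuous T}, mc_dom e (T v) &
     mc_map e (T v) = v]) ->
  semian_at aM A (T u) -> semian_at (@std_manifold n) (T @^-1` A) u.
Proof.
move=> ae oO Ou OT; apply: (semian_at_pull oO) => // [v /OT[]//|W f oW af].
have [g ag gf] := af e ae.
have OTo : open (O `&` T @^-1` W).
  by apply: continuous_openI => // v /OT[].
apply: std_manifold_analytic => v [Ov Wv]; have [_ ev Tv] := OT v Ov.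
apply: (@analytic_at_ext _ _ g); last by apply: ag; exists (T v).
apply: filterS (open_nbhs_nbhs (conj OTo (conj Ov Wv))) => w /= [Ow Ww].
have [_ ew Tw] := OT w Ow.
by rewrite -[in LHS]Tw gf.
Qed.

(** From [R^n] to a manifold with a single, global chart [e]. *)
Lemma semian_at_single_chart (e : mchart R n M) (A : set 'rV[R]_n) x :
  aM `<=` [set e] -> mc_dom e = setT ->
  continuous (mc_map e) ->
  semian_at (@std_manifold n) A (mc_map e x) ->
  semian_at aM (mc_map e @^-1` A) x.
Proof.
move=> aMe eT ce; apply: (@semian_at_pull _ _ _ _ _ _ _ setT) => //.
- exact: openT.
- by move=> y _; exact: ce.
- move=> W f oW af _ /aMe ->; exists f => //= _ [y [[_ Wy] _] <-].
  exact: (std_analytic_on oW af).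
Qed.

End Manifold.

Lemma semian_at_analytic n m (T : 'rV[R]_n -> 'rV[R]_m) (O : set 'rV[R]_n) A u :
  open O -> O u -> analytic_map O T ->
  semian_at (@std_manifold m) A (T u) -> semian_at (@std_manifold n) (T @^-1` A) u.
Proof.
move=> oO Ou aT; have cT v : O v -> {for v, continuous T}.
  by move=> Ov; apply: analytic_at_continuous => j; exact: aT.
apply: (semian_at_pull oO) => // W f oW /(std_analytic_on oW) af.
apply: std_manifold_analytic => v [Ov Wv].
by apply: analytic_at_comp; [exact: af|move=> j; exact: aT].
Qed.

Lemma semian_at_pos n (f : 'rV[R]_n -> R) u : (forall v, analytic_at f v) ->
  semian_at (@std_manifold n) [set v | 0 < f v] u.
Proof.
move=> af; exists setT; first by split; [exact: openT|].
rewrite [X in S_analytic _ _ X](_ : _ = [set v | setT v /\ 0 < f v]).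
  by apply: S_analytic_pos; apply: std_manifold_analytic => v _.
by apply/seteqP; split=> v /= [].
Qed.

Lemma semian_at_ball n (b : 'rV[R]_n) (r : R) u : 0 < r ->
  semian_at (@std_manifold n) [set v | `|v - b| < r] u.
Proof.
move=> r0; pose P (j : 'I_n) :=
  [set v : 'rV[R]_n | 0 < r + b 0 j - v 0 j] `&` [set v | 0 < v 0 j + (r - b 0 j)].
apply: (@semian_at_near _ _ _ [set v | forall j, j \in enum 'I_n -> P j v]).
  apply: filterS filterT => v _; split=> [Pv|vr j _]; last first.
    have := le_lt_trans (normr_coord_le (v - b) j) vr.
    by rewrite !mxE ltr_norml => /andP[? ?]; split => /=; lra.
  have /= -> : `|v - b| = \big[Order.max/0]_j `|(v - b) 0 j|.
    rewrite [LHS]/Num.norm /= mx_normrE.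
    rewrite (reindex (fun j : 'I_n => (0 : 'I_1, j))) //=.
    by exists snd => // -[i j] _; rewrite ord1.
  apply: bigmax_lt => // j _; have [] := Pv j (mem_enum _ _).
  by rewrite /= !mxE ltr_norml => ? ?; apply/andP; split; lra.
apply: semian_at_bigI => j _; apply: semian_atI; apply: semian_at_pos => v.
  apply: analytic_atD; first exact: analytic_at_cst.
  exact/analytic_atN/analytic_at_coord.
by apply: analytic_atD; [exact: analytic_at_coord|exact: analytic_at_cst].
Qed.

End Germs.

(** * Local transitions between orbifold charts *)

Section Transitions.
Variable R : realType.

(** A real analytic map [T], defined near the point [z] of the chart [c] and
    sending it to the point [z'] of the chart [d], which is compatible with the
    projections to the orbifold. *)
Definition chart_transition n (X : topologicalType) (c : orbchart R n X)
    (z : 'rV[R]_n) (d : orbchart R n X) (z' : 'rV[R]_n) : Prop :=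
  exists O T, [/\ open O /\ O z, O `<=` oc_dom c, analytic_map O T, T z = z' &
    forall u, O u -> oc_dom d (T u) /\ oc_map d (T u) = oc_map c u].

(** The preimage of [A] in the domain of the chart, as a subset of [R^n]. *)
Definition chart_preim n (X : topologicalType) (c : orbchart R n X)
    (A : set X) : set 'rV[R]_n :=
  [set u | oc_dom c u /\ A (oc_map c u)].

(** Any two points of charts in the family [F] lying over the same point of
    the orbifold are related by a transition. *)
Definition coherent n (X : topologicalType) (F : orbatlas R n X) : Prop :=
  forall c d z z', F c -> F d -> oc_dom c z -> oc_dom d z' ->
    oc_map c z = oc_map d z' -> chart_transition c z d z'.

Section OneOrbifold.
Variables (n : nat) (X : topologicalType).
Implicit Types (c d e f : orbchart R n X) (F : orbatlas R n X).

Lemma analytic_map_comp k m l (U : set 'rV[R]_k) (V : set 'rV[R]_m)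
    (g : 'rV[R]_k -> 'rV[R]_m) (f : 'rV[R]_m -> 'rV[R]_l) :
  analytic_map U g -> analytic_map V f -> (forall u, U u -> V (g u)) ->
  analytic_map U (f \o g).
Proof.
move=> ag af UV j u Uu; apply: (@analytic_at_comp _ _ _ (fun x => f x 0 j) g).
  by apply: af; exact: UV.
by move=> i; exact: ag.
Qed.

Lemma analytic_mapS k m (U V : set 'rV[R]_k) (g : 'rV[R]_k -> 'rV[R]_m) :
  V `<=` U -> analytic_map U g -> analytic_map V g.
Proof. by move=> VU ag j u Vu; apply: ag; exact: VU. Qed.

Lemma analytic_map_continuous k m (U : set 'rV[R]_k) (g : 'rV[R]_k -> 'rV[R]_m) u :
  analytic_map U g -> U u -> {for u, continuous g}.
Proof. by move=> ag Uu; apply: analytic_at_continuous => j; exact: ag. Qed.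

Lemma analytic_map_id k (U : set 'rV[R]_k) : analytic_map U id.
Proof. by move=> j u _; exact: analytic_at_coord. Qed.

Lemma chart_transition_trans c d e z z' z'' :
  chart_transition c z d z' -> chart_transition d z' e z'' ->
  chart_transition c z e z''.
Proof.
move=> [W [T [[oW Wz] Wc aT Tz WT]]] [P [S [[oP Pz] Pd aS Sz PS]]].
exists (W `&` T @^-1` P), (S \o T); split.
- split; last by split; rewrite /= ?Tz.
  by apply: continuous_openI => // u Wu; exact: analytic_map_continuous aT Wu.
- by move=> u [/Wc].
- apply: (@analytic_map_comp _ _ _ _ P) => //; last by move=> u [].
  by apply: analytic_mapS aT => u [].
- by rewrite /= Tz.
- by move=> u [Wu Pu]; have [? <-] := WT u Wu; exact: PS.
Qed.

Lemma semian_at_transition c d z z' A : chart_transition c z d z' ->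
  semian_at (@std_manifold R n) (chart_preim d A) z' ->
  semian_at (@std_manifold R n) (chart_preim c A) z.
Proof.
move=> [W [T [[oW Wz] Wc aT Tz WT]]] sA.
have := semian_at_analytic (A := chart_preim d A) oW Wz aT.
rewrite Tz => /(_ sA); apply: semian_at_near.
apply: filterS (open_nbhs_nbhs (conj oW Wz)) => u Wu.
have [dT mT] := WT u Wu; rewrite /chart_preim /preimage /= mT.
by split => -[_ Au]; split => //; exact: Wc.
Qed.

Lemma chart_transition_act c g z : analytic_orbifold_chart c -> oc_dom c z ->
  chart_transition c z c (oc_act c g z).
Proof.
move=> [[[oc _] [cg _ _ _] _ mc _] ac] cz.
exists (oc_dom c), (oc_act c g); split => // u cu; split; first exact: cg.
by apply/esym/mc => //; [exact: cg|exists g].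
Qed.

(** An embedding of charts gives transitions in both directions. *)
Lemma embedsP c d : analytic_orbifold_chart c -> embeds c d ->
  exists lam : 'rV[R]_n -> 'rV[R]_n, forall w, oc_dom c w ->
    [/\ oc_dom d (lam w), oc_map d (lam w) = oc_map c w,
        chart_transition c w d (lam w) & chart_transition d (lam w) c w].
Proof.
move=> [[[oc _] _ _ _ _] _] [lam [h [[_ _ [lf _] _ lm] [al oi [g ag gl]]]]].
exists lam => w cw; split; [exact: lf|exact: lm| |].
  by exists (oc_dom c), lam; split => // u cu; split; [exact: lf|exact: lm].
exists (lam @` oc_dom c), g; split.
- by split; last exists w.
- by move=> _ [u cu <-]; exact: lf.
- exact: ag.
- exact: gl.
- by move=> _ [u cu <-]; rewrite gl// lm.
Qed.

Lemma coherent_atlas F : analytic_orbifold_atlas F -> coherent F.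
Proof.
move=> [Fc _ FF] c d z z' Fc' Fd cz dz' zz'.
have cimg : oc_img c (oc_map c z) by exists z.
have dimg : oc_img d (oc_map c z) by exists z'.
have [e Fe [[w ew ewz] _ ec ed]] := FF c d _ Fc' Fd cimg dimg.
have [lam lamP] := embedsP (Fc _ Fe) ec; have [mu muP] := embedsP (Fc _ Fe) ed.
have [clw mlw _ lc] := lamP w ew; have [dmw mmw md _] := muP w ew.
have [[_ _ _ mc _] _] := Fc c Fc'; have [[_ _ _ md' _] _] := Fc d Fd.
have [g glw] : exists g, lam w = oc_act c g z by apply/mc => //; rewrite mlw.
have [h hz'] : exists h, z' = oc_act d h (mu w).
  by apply/md' => //; rewrite mmw -zz'.
apply: (chart_transition_trans (chart_transition_act g (Fc _ Fc') cz)).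
rewrite -glw; apply: (chart_transition_trans lc).
apply: (chart_transition_trans md); rewrite hz'.
exact: chart_transition_act (Fc _ Fd) dmw.
Qed.

(** A chart of a common refinement connects the charts of equivalent atlases. *)
Lemma transition_cross F F' c d z z' :
  coherent F -> analytic_orbifold_atlas F' -> atlas_equiv F F' ->
  F c -> F' d -> oc_dom c z -> oc_dom d z' -> oc_map c z = oc_map d z' ->
  chart_transition c z d z' /\ chart_transition d z' c z.
Proof.
move=> hF aF' [E [[Ec Ex EE] EF EF']] Fc F'd cz dz' zz'.
have hF' := coherent_atlas aF'.
have [e Ee [w ew ewz]] := Ex (oc_map c z).
have [q Fq eq] := EF e Ee; have [q' F'q' eq'] := EF' e Ee.
have [lam lamP] := embedsP (Ec _ Ee) eq; have [mu muP] := embedsP (Ec _ Ee) eq'.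
have [clw mlw el le] := lamP w ew; have [dmw mmw em me] := muP w ew.
have e1 : oc_map c z = oc_map q (lam w) by rewrite mlw.
have e2 : oc_map q' (mu w) = oc_map d z' by rewrite mmw -zz'.
split.
  apply: (chart_transition_trans (hF _ _ _ _ Fc Fq cz clw e1)).
  apply: (chart_transition_trans le); apply: (chart_transition_trans em).
  exact: hF'.
apply: (chart_transition_trans (hF' _ _ _ _ F'd F'q' dz' dmw (esym e2))).
apply: (chart_transition_trans me); apply: (chart_transition_trans el).
by apply: hF.
Qed.

Lemma coherent_maximal F : analytic_orbifold_atlas F -> coherent (maximal_atlas F).
Proof.
move=> aF c d z z' [F1 [aF1 FF1 F1c]] [F2 [aF2 FF2 F2d]] cz dz' zz'.
have [_ Fx _] := aF; have [a Fa [w aw waz]] := Fx (oc_map c z).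
have hF := coherent_atlas aF.
have [_ ca] := transition_cross hF aF1 FF1 Fa F1c aw cz waz.
have [ad _] := transition_cross hF aF2 FF2 Fa F2d aw dz' (etrans waz zz').
exact: chart_transition_trans ca ad.
Qed.

Lemma embeds_refl c : analytic_orbifold_chart c -> embeds c c.
Proof.
move=> [[[oc _] _ _ _ _] _]; exists id, id; split; split.
- by split.
- by split => // g kg; exists g.
- split=> [//|]; have cid : {within oc_dom c, continuous id}.
    by apply: continuous_subspaceT => x.
  by split => //; exists id => //; rewrite image_id.
- by [].
- by [].
- exact: analytic_map_id.
- by rewrite image_id.
- by exists id => //; exact: analytic_map_id.
Qed.

Lemma atlas_equiv_refl F : analytic_orbifold_atlas F -> atlas_equiv F F.
Proof.
move=> aF; have [Fc _ _] := aF; exists F; split => // c /[dup] Fc' /Fc ac;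
by exists c => //; exact: embeds_refl.
Qed.

Lemma maximal_atlas_sub F c : analytic_orbifold_atlas F -> F c ->
  maximal_atlas F c.
Proof. by move=> aF Fc; exists F; split => //; exact: atlas_equiv_refl. Qed.

End OneOrbifold.

Lemma coherent_prod n m (X Y : topologicalType) (aX : orbatlas R n X)
    (aY : orbatlas R m Y) :
  analytic_orbifold_atlas aX -> analytic_orbifold_atlas aY ->
  coherent (prod_orbifold aX aY).
Proof.
move=> hX hY _ _ z z' [c [d [mc md ->]]] [c' [d' [mc' md' ->]]].
move=> /= [cz dz] [cz' dz'] [zz1 zz2].
have [W [T [[oW Wz] Wc aT Tz WT]]] := coherent_maximal hX mc mc' cz cz' zz1.
have [P [S [[oP Pz] Pd aS Sz PS]]] := coherent_maximal hY md md' dz dz' zz2.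
exists [set u : 'rV_(n + m) | W (lsubmx u) /\ P (rsubmx u)],
  (fun u => row_mx (T (lsubmx u)) (S (rsubmx u))); split.
- by split; [exact: open_prod_rV|].
- by move=> u [/Wc ? /Pd].
- move=> j u [Wu Pu]; apply: analytic_row_mx => i.
    apply: (@analytic_at_comp _ _ _ (fun x => T x 0 i) lsubmx); first exact: aT.
    exact: analytic_lsubmx.
  apply: (@analytic_at_comp _ _ _ (fun x => S x 0 i) rsubmx); first exact: aS.
  exact: analytic_rsubmx.
- by rewrite Tz Sz hsubmxK.
- move=> u [/WT[d1 d2] /PS[d3 d4]] /=.
  by rewrite row_mxKl row_mxKr d2 d4.
Qed.

End Transitions.

(** * Products of orbifold charts *)

Section ChartTopology.
Variables (R : realType) (n : nat) (X : topologicalType) (c : orbchart R n X).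
Hypothesis hc : analytic_orbifold_chart c.

Lemma orbchart_open_map W : open W -> W `<=` oc_dom c -> open (oc_map c @` W).
Proof.
move: hc => [[[oc _] [cg c1 cM _] _ mc oq] ac] oW Wc.
apply/oq; first by move=> _ [w Ww <-]; exists w => //; exact: Wc.
(* the preimage of the image of [W] is the union of its translates *)
rewrite (_ : _ `&` _ = \bigcup_g (oc_dom c `&` (oc_act c g) @^-1` W)).
  apply: bigcup_open => g _; apply: continuous_openI => // u cu.
  exact: analytic_map_continuous (ac g) cu.
apply/seteqP; split=> [u [cu [w Ww wu]]|u [g _ [cu Wgu]]].
  have /mc[//||g wg] := esym wu; first exact: Wc.
  by exists g => //; split => //=; rewrite -wg.
split => //; exists (oc_act c g u) => //.
by apply/esym/mc => //; [exact: Wc|exists g].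
Qed.

Lemma orbchart_continuous z : oc_dom c z -> {for z, continuous (oc_map c)}.
Proof.
move: hc => [[[oc _] _ oi mc oq] _] cz V; rewrite nbhsE => -[W [oW Wz] WV].
have oWi : open (W `&` oc_img c) by exact: openI.
have : open (oc_dom c `&` oc_map c @^-1` (W `&` oc_img c)).
  by apply/oq => // x [].
move=> oP; have : nbhs z (oc_dom c `&` oc_map c @^-1` (W `&` oc_img c)).
  by apply: open_nbhs_nbhs; split => //; split => //; split => //; exists z.
by apply: filterS => u [_ [/WV]].
Qed.

End ChartTopology.

Lemma connected_prod_rV (R : realType) n m (U : set 'rV[R]_n) (V : set 'rV[R]_m) :
  connected U -> connected V ->
  connected [set z : 'rV[R]_(n + m) | U (lsubmx z) /\ V (rsubmx z)].
Proof.
move=> cU cV; have [[z0 [Uz0 Vz0]]|/set0P/negP/negPn/eqP->] :=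
  pselect ([set z : 'rV[R]_(n + m) | U (lsubmx z) /\ V (rsubmx z)] !=set0); last first.
  exact: connected0.
(* a cross made of a horizontal and a vertical slice is connected, and all the
   crosses share the vertical slice through [z0] *)
pose hor (t : 'rV[R]_m) := (fun u : 'rV[R]_n => row_mx u t) @` U.
pose ver := (fun t : 'rV[R]_m => row_mx (lsubmx z0) t) @` V.
have ch t : connected (hor t).
  apply: connected_continuous_connected => //; apply: continuous_subspaceT => u.
  apply: analytic_at_continuous; apply: analytic_row_mx => j.
    exact: analytic_at_coord.
  exact: analytic_at_cst.
have cv : connected ver.
  apply: connected_continuous_connected => //; apply: continuous_subspaceT => u.
  apply: analytic_at_continuous; apply: analytic_row_mx => j.
    exact: analytic_at_cst.
  exact: analytic_at_coord.
rewrite (_ : mkset _ = \bigcup_(t in V) (hor t `|` ver)).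
  apply: bigcup_connected.
    by exists z0 => t Vt; right; exists (rsubmx z0) => //; rewrite hsubmxK.
  move=> t Vt; apply: connectedU => //.
  by exists (row_mx (lsubmx z0) t); split; [exists (lsubmx z0)|exists t].
apply/seteqP; split=> [z [Uz Vz]|z [t Vt [[u Uu <-]|[s Vs <-]]]] /=.
- by exists (rsubmx z) => //; left; exists (lsubmx z) => //; rewrite hsubmxK.
- by rewrite row_mxKl row_mxKr.
- by rewrite row_mxKl row_mxKr.
Qed.

Section ProductChart.
Variables (R : realType) (n m : nat) (X Y : topologicalType).
Implicit Types (c : orbchart R n X) (d : orbchart R m Y).

Lemma prod_img c d :
  oc_img (prod_orbchart c d) = oc_img c `*` oc_img d.
Proof.
apply/seteqP; split=> [_ [z [cz dz] <-]|[x y] [[u cu ux] [v dv vy]]] /=.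
  by split; [exists (lsubmx z)|exists (rsubmx z)].
exists (row_mx u v); first by split; rewrite ?row_mxKl ?row_mxKr.
by rewrite /= row_mxKl row_mxKr ux vy.
Qed.

Lemma analytic_map_prod k l (U : set 'rV[R]_n) (V : set 'rV[R]_m)
    (f : 'rV[R]_n -> 'rV[R]_k) (g : 'rV[R]_m -> 'rV[R]_l) :
  analytic_map U f -> analytic_map V g ->
  analytic_map [set z : 'rV[R]_(n + m) | U (lsubmx z) /\ V (rsubmx z)]
    (fun z => row_mx (f (lsubmx z)) (g (rsubmx z))).
Proof.
move=> af ag j u [Ou Pu]; apply: analytic_row_mx => i.
  apply: (@analytic_at_comp _ _ _ (fun x => f x 0 i) lsubmx); first exact: af.
  exact: analytic_lsubmx.
apply: (@analytic_at_comp _ _ _ (fun x => g x 0 i) rsubmx); first exact: ag.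
exact: analytic_rsubmx.
Qed.

Lemma prod_orbchart_analytic c d :
  analytic_orbifold_chart c -> analytic_orbifold_chart d ->
  analytic_orbifold_chart (prod_orbchart c d).
Proof.
move=> hc hd; have [[[oc cc] [cg c1 cM _] oic mc oqc] ac] := hc.
have [[[od cd] [dg d1 dM _] oid md oqd] ad] := hd.
have ap g : analytic_map (oc_dom (prod_orbchart c d)) (oc_act (prod_orbchart c d) g).
  exact: analytic_map_prod.
have op : open (oc_dom (prod_orbchart c d)) by exact: open_prod_rV.
split=> //; split.
- by split => //; exact: connected_prod_rV.
- split.
  + by move=> g z [cz dz] /=; rewrite row_mxKl row_mxKr; split; [exact: cg|exact: dg].
  + by move=> z [cz dz] /=; rewrite c1// d1// hsubmxK.
  + by move=> g h z [cz dz] /=; rewrite row_mxKl row_mxKr cM// dM.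
  + by move=> g; exact: analytic_map_within.
- rewrite prod_img openE => -[x y] [/= cx dy].
  by exists (oc_img c, oc_img d) => //; split; exact: open_nbhs_nbhs.
- move=> z w [cz dz] [cw dw] /=; split.
    case=> /mc[//|//|g wz] /md[//|//|h wz'].
    by exists (g, h); rewrite /= -wz -wz' hsubmxK.
  move=> [[g h] /= ->]; rewrite row_mxKl row_mxKr; congr (_, _).
    by apply/mc => //; [exact: cg|exists g].
  by apply/md => //; [exact: dg|exists h].
- move=> W Wi; split=> [oW|oP].
    apply: continuous_openI => // z [cz dz].
    have c1' : {for z, continuous (oc_map c \o lsubmx)}.
      by apply: continuous_comp; [exact: lsubmx_continuous|exact: orbchart_continuous].
    have c2' : {for z, continuous (oc_map d \o rsubmx)}.
      by apply: continuous_comp; [exact: rsubmx_continuous|exact: orbchart_continuous].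
    exact: cvg_pair c1' c2'.
  rewrite openE => -[x y] Wxy.
  have [z [cz dz] [zx zy]] := Wi _ Wxy.
  have : nbhs (row_mx (lsubmx z) (rsubmx z)) (oc_dom (prod_orbchart c d) `&`
      oc_map (prod_orbchart c d) @^-1` W).
    by apply: open_nbhs_nbhs; rewrite hsubmxK; split => //; split => //=; rewrite zx zy.
  move=> /nbhs_row_mx[e e0 eP].
  pose U := oc_dom c `&` ball (lsubmx z) e.
  pose V := oc_dom d `&` ball (rsubmx z) e.
  have oU : open U by apply: openI => //; exact: ball_open.
  have oV : open V by apply: openI => //; exact: ball_open.
  exists (oc_map c @` U, oc_map d @` V) => /=.
    split; apply: open_nbhs_nbhs; split.
    + by apply: orbchart_open_map => // u [].
    + by exists (lsubmx z) => //; split => //; exact: ballxx.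
    + by apply: orbchart_open_map => // u [].
    + by exists (rsubmx z) => //; split => //; exact: ballxx.
  move=> [x' y'] [/= [u [cu zu] <-] [v [dv zv] <-]].
  have [] := eP u v.
  + by move: zu; rewrite -ball_normE /= distrC.
  + by move: zv; rewrite -ball_normE /= distrC.
  + by move=> _ /=; rewrite row_mxKl row_mxKr.
Qed.

End ProductChart.

Section ProductEmbedding.
Variables (R : realType) (n m : nat) (X Y : topologicalType).

(** The domains must be nonempty: otherwise the kernel of the product chart is
    the whole product group, which need not correspond to the kernel of the
    target. *)
Lemma prod_embeds (c c' : orbchart R n X) (d d' : orbchart R m Y) :
  analytic_orbifold_chart c -> analytic_orbifold_chart d ->
  oc_dom c !=set0 -> oc_dom d !=set0 ->
  embeds c c' -> embeds d d' -> embeds (prod_orbchart c d) (prod_orbchart c' d').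
Proof.
move=> hc hd [z0 cz0] [w0 dw0].
have [[[oc _] _ _ _ _] _] := hc; have [[[od _] _ _ _ _] _] := hd.
move=> [f [h [[[hM hI] [hk hki hks] [ff _] fh fm] [af of_ [g ag gf]]]]].
move=> [f' [h' [[[h'M h'I] [h'k h'ki h'ks] [ff' _] fh' fm'] [af' of' [g' ag' gf']]]]].
pose F (z : 'rV[R]_(n + m)) : 'rV[R]_(n + m) :=
  row_mx (f (lsubmx z)) (f' (rsubmx z)).
pose G (z : 'rV[R]_(n + m)) : 'rV[R]_(n + m) :=
  row_mx (g (lsubmx z)) (g' (rsubmx z)).
have op : open (oc_dom (prod_orbchart c d)) by exact: open_prod_rV.
have Fi : F @` oc_dom (prod_orbchart c d) =
    [set z | (f @` oc_dom c) (lsubmx z) /\ (f' @` oc_dom d) (rsubmx z)].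
  apply/seteqP; split=> [_ [z [cz dz] <-]|z [[u cu uz] [v dv vz]]].
    by rewrite /= row_mxKl row_mxKr; split; [exists (lsubmx z)|exists (rsubmx z)].
  exists (row_mx u v); first by rewrite /= row_mxKl row_mxKr.
  by rewrite /F row_mxKl row_mxKr uz vz hsubmxK.
have oFi : open (F @` oc_dom (prod_orbchart c d)) by rewrite Fi; exact: open_prod_rV.
have aF : analytic_map (oc_dom (prod_orbchart c d)) F by exact: analytic_map_prod.
have aG : analytic_map (F @` oc_dom (prod_orbchart c d)) G.
  by rewrite Fi; exact: analytic_map_prod.
have GF z : oc_dom (prod_orbchart c d) z -> G (F z) = z.
  by move=> [cz dz]; rewrite /G /F row_mxKl row_mxKr gf// gf'// hsubmxK.
have kerE (a : orbchart R n X) (b : orbchart R m Y) g0 :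
    oc_dom a !=set0 -> oc_dom b !=set0 ->
    oc_ker (prod_orbchart a b) g0 <-> oc_ker a g0.1 /\ oc_ker b g0.2.
  move=> [u au] [v bv]; split=> [k0|[k1 k2] z [az bz] /=]; last first.
    by rewrite k1// k2// hsubmxK.
  split=> [x ax|y by_].
    have := k0 (row_mx x v); rewrite /= row_mxKl row_mxKr => /(_ (conj ax bv)).
    by move=> /eq_row_mx[].
  have := k0 (row_mx u y); rewrite /= row_mxKl row_mxKr => /(_ (conj au by_)).
  by move=> /eq_row_mx[].
have ne : oc_dom c !=set0 by exists z0.
have ne' : oc_dom d !=set0 by exists w0.
have nf : oc_dom c' !=set0 by exists (f z0); exact: ff.
have nf' : oc_dom d' !=set0 by exists (f' w0); exact: ff'.
exists F, (fun g0 => (h g0.1, h' g0.2)); split; split => //.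
- split; first by move=> g1 g2; rewrite /= hM h'M.
  by move=> [x1 x2] [y1 y2] /= [/hI -> /h'I ->].
- split.
  + by move=> g0 /kerE[]// k1 k2; apply/kerE => //; split; [exact: hk|exact: h'k].
  + move=> [x1 x2] [y1 y2] /set_mem/kerE[]// ? ? /set_mem/kerE[]// ? ? /= [].
    by move=> /hI -> /h'I ->.
  + move=> [y1 y2] /kerE[]// /= /hks[x1 k1 <-] /h'ks[x2 k2 <-].
    by exists (x1, x2) => //; apply/kerE.
- split; first move=> z [cz dz].
    by rewrite /F /= row_mxKl row_mxKr; split; [exact: ff|exact: ff'].
  split; first exact: analytic_map_within.
  by exists G => //; exact: analytic_map_within.
- by move=> g0 z [cz dz]; rewrite /F /= !row_mxKl !row_mxKr fh// fh'.
- by move=> z [cz dz]; rewrite /F /= !row_mxKl !row_mxKr fm// fm'.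
- by exists G.
Qed.

Variables (aX : orbatlas R n X) (aY : orbatlas R m Y).

(** The products of charts of the given atlases only; unlike [prod_orbifold] it
    leaves out the other charts of the maximal atlases. *)
Definition small_prod : orbatlas R (n + m) (X * Y)%type :=
  fun e => exists c d, [/\ aX c, aY d & e = prod_orbchart c d].

Lemma small_prod_atlas : analytic_orbifold_atlas aX ->
  analytic_orbifold_atlas aY -> analytic_orbifold_atlas small_prod.
Proof.
move=> [Xc Xx XX] [Yc Yy YY]; split.
- move=> _ [c [d [Xc' Yd' ->]]].
  by apply: prod_orbchart_analytic; [exact: Xc|exact: Yc].
- move=> [x y]; have [c ac cx] := Xx x; have [d ad dy] := Yy y.
  by exists (prod_orbchart c d); [exists c, d|rewrite prod_img].
- move=> _ _ [x y] [c [d [ac ad ->]]] [c' [d' [ac' ad' ->]]].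
  rewrite !prod_img => -[/= cx dy] [/= cx' dy'].
  have [e ae [ex ecc' ec ec']] := XX c c' x ac ac' cx cx'.
  have [f af [fy fdd' fd fd']] := YY d d' y ad ad' dy dy'.
  have ne : oc_dom e !=set0 by case: ex => z ez _; exists z.
  have nf : oc_dom f !=set0 by case: fy => z fz _; exists z.
  exists (prod_orbchart e f); first by exists e, f.
  rewrite !prod_img; split => //.
  + by move=> [x' y'] [/ecc'[? ?] /fdd'[? ?]].
  + by apply: prod_embeds => //; [exact: Xc|exact: Yc].
  + by apply: prod_embeds => //; [exact: Xc|exact: Yc].
Qed.

(** [small_prod] is an atlas which refines [prod_orbifold], hence is itself a
    common refinement of the two. *)
Lemma prod_chart_maximal c d : analytic_orbifold_atlas aX ->
  analytic_orbifold_atlas aY -> aX c -> aY d ->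
  maximal_atlas (prod_orbifold aX aY) (prod_orbchart c d).
Proof.
move=> hX hY ac ad; have hP := small_prod_atlas hX hY; have [Pc _ _] := hP.
exists small_prod; split => //; last by exists c, d.
exists small_prod; split => // e /[dup] Pe [a [b [Xa Yb eab]]].
  exists e; last exact: embeds_refl (Pc _ Pe).
  by exists a, b; split => //; exact: maximal_atlas_sub.
by exists e => //; exact: embeds_refl (Pc _ Pe).
Qed.

End ProductEmbedding.

(** * The topology of [R^n], and [R^n] as an orbifold *)

Lemma compact_finite_cover (T : topologicalType) (K : set T) (N : T -> set T) :
  compact K -> (forall x, open_nbhs x (N x)) ->
  exists s : seq T, K `<=` [set y | exists2 x, x \in s & N x y].
Proof.
move=> /compact_near_coveringP cK oN.
(* finite sequences, directed by inclusion of their sets of entries *)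
pose G : set_system (seq T) :=
  filter_from setT (fun s0 : seq T => [set s : seq T | {subset s0 <= s}]).
have GF : ProperFilter G.
  apply: filter_from_proper; last by move=> s0 _; exists s0.
  apply: filter_from_filter; first by exists [::].
  move=> s1 s2 _ _; exists (s1 ++ s2) => // s /= ss.
  by split=> x xs; apply: ss; rewrite mem_cat xs ?orbT.
suff : \forall s \near G, K `<=` (fun y => exists2 x, x \in s & N x y).
  by move=> nG; have [s sP] := @filter_ex _ _ GF _ nG; exists s.
apply: (cK _ G (fun (s : seq T) y => exists2 x, x \in s & N x y)) => x Kx.
exists (N x, [set s : seq T | x \in s]) => /=.
  split; first exact: open_nbhs_nbhs.
  by exists [:: x] => // s /= ss; apply: ss; rewrite mem_head.
by move=> [y s] /= [Ny xs]; exists x.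
Qed.

Section RnTopology.
Variables (R : realType) (n : nat).
Notation Rn := 'rV[R]_n.

Lemma closed_ball_rV_compact (b : Rn) (r : R) :
  compact [set x : Rn | `|x - b| <= r].
Proof.
apply: bounded_closed_compact.
  exists (`|b| + r); split; first exact: num_real.
  move=> M Mr x /= xr; apply: le_trans (ltW Mr).
  by rewrite -[x](subrK b) [leRHS]addrC (le_trans (ler_normD _ _))// lerD2r.
rewrite (_ : mkset _ = closed_ball_ Num.norm b r); first exact: closed_closed_ball_.
by apply/seteqP; split=> x /=; rewrite distrC.
Qed.

Lemma open_ball_rV (b : Rn) (r : R) : open [set x : Rn | `|x - b| < r].
Proof.
have := @ball_open _ Rn b r; rewrite -ball_normE.
rewrite (_ : mkset _ = ball_ Num.norm b r)//.
by apply/seteqP; split=> x /=; rewrite distrC.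
Qed.

Lemma rV_hausdorff : hausdorff_space Rn.
Proof. exact: norm_hausdorff. Qed.

Lemma closed_ball_rV_closed (b : Rn) (r : R) : closed [set x : Rn | `|x - b| <= r].
Proof.
by apply: compact_closed; [exact: rV_hausdorff|exact: closed_ball_rV_compact].
Qed.

Lemma open_ball_rVC (b : Rn) (r : R) : open [set x : Rn | r < `|x - b|].
Proof.
have := closed_openC (@closed_ball_rV_closed b r); congr open.
by apply/seteqP; split=> x /=; rewrite ltNge => /negP.
Qed.

Lemma rV_connected : connected [set: Rn].
Proof.
rewrite (_ : setT = \bigcup_(v in [set: Rn]) ((fun t : R => t *: v) @` `[0, 1])).
  apply: bigcup_connected.
    by exists 0 => v _; exists 0; rewrite ?scale0r//= in_itv /= lexx ler01.
  move=> v _; apply: connected_continuous_connected; first exact: segment_connected.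
  by apply: continuous_subspaceT; exact: scalel_continuous.
apply/seteqP; split=> v // _; exists v => //; exists 1; rewrite ?scale1r//=.
by rewrite in_itv /= lexx ler01.
Qed.

Lemma rV_countable_components : countably_many_components Rn.
Proof.
apply: (@sub_countable _ _ _ [set [set: Rn]]); last exact: countable1.
apply: subset_card_le => _ [x _ <-] /=.
by apply: connected_component_id => //; exact: rV_connected.
Qed.

Lemma rV_second_countable : @second_countable Rn.
Proof.
pose f (qk : 'rV[rat]_n * nat) : set Rn :=
  [set x | `|x - map_mx ratr qk.1| < qk.2.+1%:R^-1].
exists (range f).
  by apply: sub_countable (card_image_le _ _) _; exact: countableP.
split; first by move=> _ [qk _ <-]; exact: open_ball_rV.
move=> x V /nbhs_normP[e /= e0 eV].
have e20 : 0 < e / 2 by rewrite divr_gt0.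
have [k] := ltr_add_invr e20; rewrite add0r.
set t : R := k.+1%:R^-1 => te; have t0 : 0 < t by rewrite invr_gt0.
have fE q : f (q, k) = [set x | `|x - map_mx ratr q| < t] by [].
move: t te t0 fE => t te t0 fE.
have /choice[q xq] : forall j, exists q : rat, `|x 0 j - ratr q| <= t / 2.
  move=> j; have : x 0 j - t / 2 < x 0 j + t / 2 by lra.
  move=> /rat_in_itvoo[q]; rewrite in_itv /= => /andP[q1 q2]; exists q.
  by rewrite ler_norml; apply/andP; split; lra.
have xk : `|x - map_mx ratr (\row_j q j)| < t.
  apply: (@le_lt_trans _ _ (t / 2)); last lra.
  by apply: normr_le_rV => [|j]; [lra|rewrite !mxE].
exists (f (\row_j q j, k)); first by split; [exists (\row_j q j, k)|rewrite fE].
move=> y; rewrite fE => fy; apply: eV => /=.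
rewrite -(subrK (map_mx ratr (\row_j q j)) x) -addrA.
apply: le_lt_trans (ler_normD _ _) _; rewrite [X in _ + X]distrC.
by move: fy xk => /=; lra.
Qed.

(** Each ball of integral radius is covered by finitely many sets of the given
    cover; these are cut down to shells around
    the origin. *)
Lemma rV_paracompact : paracompact Rn.
Proof.
move=> C Co Cc.
have /choice[U UP] : forall x : Rn, exists U, C U /\ U x.
  move=> x; have : (\bigcup_(U in C) U) x by rewrite Cc.
  by move=> [U CU Ux]; exists U.
have UoN x : open_nbhs x (U x) by have [CU Ux] := UP x; split => //; exact: Co.
have /choice[s sP] := fun k : nat =>
  compact_finite_cover (@closed_ball_rV_compact 0 k.+1%:R) UoN.
pose shell k : set Rn := [set y | k%:R - 1 < `|y| /\ `|y| < k.+2%:R].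
pose D := [set W | exists k x, x \in s k /\ W = U x `&` shell k].
have oshell k : open (shell k).
  rewrite (_ : shell k = (Num.norm @^-1` [set t | t > k%:R - 1]) `&`
     (Num.norm @^-1` [set t | t < k.+2%:R])); last by [].
  apply: openI; apply: open_comp; try by move=> x _; exact: norm_continuous.
    exact: open_gt.
  exact: open_lt.
exists D; split.
- by move=> _ [k [x [_ ->]]]; apply: openI => //; exact: (UoN x).1.
- apply/seteqP; split=> y // _; pose k := Num.truncn `|y|.
  have /andP[k1 k2] := Num.Theory.truncn_itv (normr_ge0 y).
  have [|x xs Uy] := sP k y; first by rewrite /= subr0 ltW.
  exists (U x `&` shell k); first by exists k, x.
  split => //; split; first by rewrite -/k in k1; lra.
  by apply: lt_trans k2 _; rewrite ltr_nat.
- by move=> _ [k [x [_ ->]]]; exists (U x); [exact: (UP x).1|move=> y []].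
move=> p; exists [set y | `|y - p| < 1].
  by apply: open_nbhs_nbhs; split; [exact: open_ball_rV|rewrite /= subrr normr0].
pose K := (Num.truncn (`|p| + 2)).+1.
apply: (@sub_finite_set _ _
  (\bigcup_(k in `I_K) (fun x => U x `&` shell k) @` [set` s k])).
  move=> _ [[k [x [xs ->]]] [y [[_ [yk _]] yp]]]; exists k; last by exists x.
  rewrite /= /K ltnS truncn_ge_nat ?addr_ge0//.
  have : `|y| <= `|y - p| + `|p| by rewrite -{1}(subrK p y) ler_normD.
  by move: yk yp => /=; lra.
apply: bigcup_finite => // k _; exact: finite_image.
Qed.

End RnTopology.

Lemma relatively_compact_prod (X Y : topologicalType) (K : set X) (L : set Y)
    (B : set (X * Y)%type) :
  closed K -> closed L -> compact K -> compact L -> B `<=` K `*` L ->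
  relatively_compact B.
Proof.
move=> oK oL cK cL BKL; apply: (subclosed_compact _ (compact_setX cK cL)).
  exact: closed_closure.
rewrite closureE => x; apply; split => //.
rewrite (_ : K `*` L = fst @^-1` K `&` snd @^-1` L); last by [].
apply: closedI; apply: closed_comp => // z _.
- exact: cvg_fst.
- exact: cvg_snd.
Qed.

Section Euclidean.
Variables (R : realType) (n : nat).

(** [R^n] as an orbifold chart of itself; the chart group is trivial. *)
Definition rV_orbchart : orbchart R n 'rV[R]_n :=
  @OrbChart R n 'rV[R]_n [set: 'rV[R]_n] {perm 'I_0} (fun _ x => x) id.

Definition rV_orbatlas : orbatlas R n 'rV[R]_n := fun c => c = rV_orbchart.

Lemma rV_orbchart_analytic : analytic_orbifold_chart rV_orbchart.
Proof.
have iT : oc_img rV_orbchart = setT by rewrite /oc_img /= image_id.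
split; last by move=> g; exact: analytic_map_id.
split.
- by split; [exact: openT|exact: rV_connected].
- by split => // g; apply: continuous_subspaceT => x.
- by rewrite iT; exact: openT.
- move=> x y _ _ /=; split=> [->|[_ ->]//]; by exists 1%g.
- by move=> W _ /=; rewrite setTI.
Qed.

Lemma rV_orbatlas_atlas : analytic_orbifold_atlas rV_orbatlas.
Proof.
have hc := rV_orbchart_analytic.
have iT : oc_img rV_orbchart = setT by rewrite /oc_img /= image_id.
split; first by move=> _ ->.
  by move=> x; exists rV_orbchart => //; rewrite iT.
move=> _ _ x -> -> _ _; exists rV_orbchart => //; rewrite iT setTI.
by split => //; exact: embeds_refl.
Qed.

Lemma rV_orbifold : (0 < n)%N -> analytic_orbifold rV_orbatlas.
Proof.
move=> n0; split; first by [].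
- exact: rV_hausdorff.
- exact: rV_paracompact.
- exact: rV_countable_components.
- exact: rV_orbatlas_atlas.
Qed.

Lemma rV_manifold : analytic_manifold (@std_manifold R n).
Proof.
split.
- by split; [exact: rV_hausdorff|exact: rV_second_countable].
- move=> _ ->; split => /=; rewrite ?image_id; try exact: openT.
  + by move=> x y _ _.
  + by move=> W _; rewrite image_id.
- by move=> x; exists (MChart setT id).
- by move=> _ _ -> ->; exists id => //; exact: analytic_map_id.
Qed.

End Euclidean.

(** * Open subsets of [R^n] as manifolds *)

Section Subtype.
Variables (R : realType) (n : nat) (V : set 'rV[R]_n).

Lemma set_val_continuous : continuous (set_val : V -> 'rV[R]_n).
Proof. exact: initial_continuous. Qed.

Lemma nbhs_set_val (v : V) (U : set V) : nbhs v U ->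
  exists2 P : set 'rV[R]_n, open_nbhs (set_val v) P & set_val @^-1` P `<=` U.
Proof. by move=> [_ [[P oP <-] /= Pv PU]]; exists P. Qed.

Hypothesis oV : open V.
Variable v0 : V.

(** The inverse of the inclusion of [V], with the junk value [v0] outside [V]. *)
Definition to_sub (u : 'rV[R]_n) : V := insubd v0 u.

Lemma to_subK u : V u -> set_val (to_sub u) = u.
Proof. by move=> Vu; rewrite /to_sub [LHS]val_insubd mem_set. Qed.

Lemma set_valK (v : V) : to_sub (set_val v) = v.
Proof. by apply: val_inj; rewrite [LHS]to_subK//; exact: set_valP. Qed.

Lemma to_sub_continuous u : V u -> {for u, continuous to_sub}.
Proof.
move=> Vu U /nbhs_set_val[P [oP]]; rewrite to_subK// => Pu PU.
have : nbhs u (V `&` P) by apply: open_nbhs_nbhs; split => //; exact: openI.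
by apply: filterS => w [Vw Pw]; apply: PU => /=; rewrite to_subK.
Qed.

Lemma compact_set_val K : K `<=` V -> compact K ->
  compact (set_val @^-1` K : set V).
Proof.
move=> KV cK; rewrite (_ : _ @^-1` _ = to_sub @` K).
  apply: continuous_compact => //; apply: continuous_in_subspaceT => u /set_mem Ku.
  exact/to_sub_continuous/KV.
apply/seteqP; split=> [v Kv|_ [u Ku <-] /=]; last by rewrite to_subK//; exact: KV.
by exists (set_val v) => //; rewrite set_valK.
Qed.

(** A semianalytic subset of [V * N], read in the chart [id * d]. *)
Lemma semian_at_prod_chart m (N : topologicalType) (aN : set (mchart R m N))
    (d : mchart R m N) (A : set (V * N)%type) u :
  aN d -> manifold_chart d -> V (lsubmx u) ->
  (mc_map d @` mc_dom d) (rsubmx u) ->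
  semianalytic (prod_manifold (open_manifold V) aN) A ->
  semian_at (@std_manifold R (n + m)) [set z | exists v y,
     [/\ A (v, y), mc_dom d y & z = row_mx (set_val v) (mc_map d y)]] u.
Proof.
move=> ad [od oid injd homd] Vu du sA.
have [y0 dy0 _] := du.
(* an inverse of the chart [d] on its image *)
have /choice[dinv dinvP] : forall t, exists y, mc_dom d y /\
    ((mc_map d @` mc_dom d) t -> mc_map d y = t).
  move=> t; have [[y dy <-]|nt] := pselect ((mc_map d @` mc_dom d) t).
    by exists y.
  by exists y0.
have dinvK y : mc_dom d y -> dinv (mc_map d y) = y.
  move=> dy; have [dd dE] := dinvP (mc_map d y).
  by apply: injd; rewrite ?inE//; apply: dE; exists y.
have cdinv t : (mc_map d @` mc_dom d) t -> {for t, continuous dinv}.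
  move=> dt W; rewrite nbhsE => -[P [oP Pt] PW].
  have oPd : open (mc_map d @` (P `&` mc_dom d)).
    by apply/homd => [y []//|]; exact: openI.
  have : nbhs t (mc_map d @` (P `&` mc_dom d)).
    apply: open_nbhs_nbhs; split => //; exists (dinv t).
      by split => //; exact: (dinvP t).1.
    exact: (dinvP t).2.
  by apply: filterS => _ [y [Py dy] <-]; apply: PW; rewrite /preimage /= dinvK.
pose D := [set z : 'rV[R]_(n + m) | V (lsubmx z) /\ (mc_map d @` mc_dom d) (rsubmx z)].
pose T (z : 'rV[R]_(n + m)) := (to_sub (lsubmx z), dinv (rsubmx z)).
have oD : open D by exact: open_prod_rV.
have nD : nbhs u D by apply: open_nbhs_nbhs.
apply: (@semian_at_near _ _ _ _ (T @^-1` A)).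
  apply: filterS nD => z [Vz dz]; split=> [Az|[v [y [Avy dy ->]]]].
    exists (to_sub (lsubmx z)), (dinv (rsubmx z)); split => //.
      exact: (dinvP _).1.
    by rewrite to_subK// (dinvP _).2// hsubmxK.
  by rewrite /preimage /T /= row_mxKl row_mxKr set_valK dinvK.
pose e := prod_mchart (MChart [set: V] (fun v : V => set_val v)) d.
apply: (@semian_at_chart _ _ _ _ e T D) => //.
- by exists (MChart [set: V] (fun v : V => set_val v)), d.
- move=> z [Vz dz]; split.
  + have c1 : {for z, continuous (to_sub \o lsubmx)}.
      by apply: continuous_comp; [exact: lsubmx_continuous|exact: to_sub_continuous].
    have c2 : {for z, continuous (dinv \o rsubmx)}.
      by apply: continuous_comp; [exact: rsubmx_continuous|exact: cdinv].
    exact: cvg_pair c1 c2.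
  + by split => //=; exact: (dinvP _).1.
  + by rewrite /= to_subK// (dinvP _).2// hsubmxK.
Qed.

(** A subset of [V * R^m] is semianalytic when the set of [R^(n + m)] that
    defines it is so at the points over [V]. *)
Lemma semianalytic_prod_std m (A : set 'rV[R]_(n + m)) :
  (forall z, V (lsubmx z) -> semian_at (@std_manifold R (n + m)) A z) ->
  semianalytic (prod_manifold (open_manifold V) (@std_manifold R m))
    [set z | A (row_mx (set_val z.1) z.2)].
Proof.
move=> sA z; pose e := prod_mchart (MChart [set: V] (fun v : V => set_val v))
  (MChart [set: 'rV[R]_m] id).
apply: (@semian_at_single_chart _ _ _ _ e A).
- by move=> _ [_ [_ [-> -> ->]]].
- by rewrite /= setXTT.
- move=> w.
  have c1 : {for w, continuous (set_val \o (fst : V * 'rV[R]_m -> V))}.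
    by apply: continuous_comp; [exact: cvg_fst|exact: set_val_continuous].
  have c2 : {for w, continuous (snd : V * 'rV[R]_m -> 'rV[R]_m)} by exact: cvg_snd.
  have c12 : {for w, continuous (fun w : V * 'rV[R]_m => (set_val w.1, w.2))}.
    exact: cvg_pair c1 c2.
  apply: (@continuous_comp _ _ _ (fun w : V * 'rV[R]_m => (set_val w.1, w.2))
    (fun w => row_mx w.1 w.2) w c12); exact: row_mx_continuous_at.
- by apply: sA; rewrite /= row_mxKl; exact: set_valP.
Qed.

End Subtype.

Section ChartPreimage.
Variables (R : realType) (n : nat) (X : topologicalType).

Lemma semianalytic_chart_preimage (c : orbchart R n X) (B : set X) :
  open (oc_dom c) ->
  semianalytic (open_manifold (oc_dom c)) (chart_preimage c B) <->
  forall z, oc_dom c z -> semian_at (@std_manifold R n) (chart_preim c B) z.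
Proof.
move=> oc; pose e := MChart [set: oc_dom c] (fun v : oc_dom c => set_val v).
split=> [sB z cz|sB v].
  pose v0 : oc_dom c := exist _ z (mem_set cz).
  apply: (@semian_at_near _ _ _ _ (to_sub v0 @^-1` chart_preimage c B)).
    apply: filterS (open_nbhs_nbhs (conj oc cz)) => w cw.
    rewrite /preimage /chart_preim /chart_preimage /= to_subK//.
    by split=> [[]//|[_ Bw]]; split => //; exists w.
  apply: (@semian_at_chart _ _ _ (open_manifold (oc_dom c)) e (to_sub v0) (oc_dom c));
    [exact: erefl|exact: oc|exact: cz| |exact: sB] => w cw.
  by split => //; [exact: to_sub_continuous|rewrite /= to_subK].
rewrite (_ : chart_preimage c B = mc_map e @^-1` chart_preim c B).
  apply: semian_at_single_chart => //; first exact: set_val_continuous.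
  by apply: sB; exact: set_valP.
apply/seteqP; split=> w /=; rewrite /chart_preimage /chart_preim /=.
  by move=> [Bw _]; split => //; exact: set_valP.
by move=> [cw Bw]; split => //; exists (set_val w).
Qed.

(** A semianalytic subset of an orbifold is semianalytic in all charts, not only
    in those of the definition. *)
Lemma orb_semianalytic_preim (F : orbatlas R n X) (B : set X) c z :
  coherent F -> orb_semianalytic F B -> F c -> oc_dom c z ->
  semian_at (@std_manifold R n) (chart_preim c B) z.
Proof.
move=> hF sB Fc cz; have [e [F' [aF' FF' F'e]] [[z' ez' zz'] sBe]] := sB (oc_map c z).
have [F'c _ _] := aF'; have [[[oe _] _ _ _ _] _] := F'c e F'e.
have [ce _] := transition_cross hF aF' FF' Fc F'e cz ez' (esym zz').
apply: (semian_at_transition ce).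
exact: (semianalytic_chart_preimage B oe).1 sBe z' ez'.
Qed.

End ChartPreimage.

(** * The projection theorem *)

Lemma seq_bounded (T : eqType) (R : realType) (s : seq T) (f : T -> R) :
  exists M, forall y, y \in s -> f y <= M.
Proof.
elim: s => [|a s [M fM]]; first by exists 0.
exists (Num.max (f a) M) => y; rewrite inE => /predU1P[->|/fM fy].
  by rewrite le_max lexx.
by rewrite le_max fy orbT.
Qed.

Section Projection.
Variables (R : realType) (n : nat) (X : topologicalType).
Variables (aX : orbatlas R n X) (hX : analytic_orbifold aX) (A : set X).

Lemma orb_subanalytic_of_projections :
  (forall x : X, exists2 U : set X, nbhs x U &
    exists (m : nat) (Y : topologicalType) (aY : orbatlas R m Y),
      analytic_orbifold aY /\
      exists B : set (X * Y)%type,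
        [/\ relatively_compact B,
            orb_semianalytic (prod_orbifold aX aY) B &
            A `&` U = fst @` B]) ->
  orb_subanalytic aX A.
Proof.
move=> hA x; have [_ _ _ _ haX] := hX; have [aXc aXx _] := haX.
have [c ac cx] := aXx x; exists c; first exact: maximal_atlas_sub.
split=> // v; have hc := aXc c ac; have [[[oc _] _ _ _ _] _] := hc.
have cv : oc_dom c (set_val v) by exact: set_valP.
have [U nU [m [Y [aY [[_ _ _ _ haY] [B [cB sB AU]]]]]]] :=
  hA (oc_map c (set_val v)).
have [aYc aYy _] := haY.
have nV : nbhs (set_val v) (oc_dom c `&` oc_map c @^-1` U).
  apply: filterI; first by apply: open_nbhs_nbhs.
  exact: (orbchart_continuous hc cv) nU.
have [r r0 rP] : exists2 r, 0 < r & forall w : 'rV[R]_n,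
    `|w - set_val v| <= r -> oc_dom c w /\ U (oc_map c w).
  move: nV => /nbhs_normP[e /= e0 eP]; exists (e / 2); first by rewrite divr_gt0.
  by move=> w we; apply: eP => /=; rewrite distrC; apply: le_lt_trans we _; lra.
exists [set w : oc_dom c | `|set_val w - set_val v| < r].
  have : nbhs (set_val v) [set w : 'rV[R]_n | `|w - set_val v| < r].
    by apply: open_nbhs_nbhs; split; [exact: open_ball_rV|rewrite /= subrr normr0].
  exact: set_val_continuous.
exists m, 'rV[R]_m, (@std_manifold R m); split; first exact: rV_manifold.
(* around each point of [Y], a chart [(k y).1.1], a point [(k y).1.2] over [y]
   and the radius [(k y).2] of a closed ball contained in the chart domain *)
have /choice[k kP] : forall y : Y, exists k : orbchart R m Y * 'rV[R]_m * R,
    [/\ aY k.1.1, oc_map k.1.1 k.1.2 = y, 0 < k.2 &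
      forall t : 'rV[R]_m, `|t - k.1.2| <= k.2 -> oc_dom k.1.1 t].
  move=> y; have [d ad [t dt ty]] := aYy y.
  have [[[od _] _ _ _ _] _] := aYc d ad.
  have : nbhs t (oc_dom d) by apply: open_nbhs_nbhs.
  move=> /nbhs_normP[e /= e0 eP]; exists (d, t, e / 2); split => //=.
    by rewrite divr_gt0.
  by move=> s st; apply: eP => /=; rewrite distrC; apply: le_lt_trans st _; lra.
pose d y := (k y).1.1; pose t y := (k y).1.2; pose rho y := (k y).2.
pose N y := oc_map (d y) @` [set s : 'rV[R]_m | `|s - t y| < rho y].
have oN y : open_nbhs y (N y).
  have [ady mty ry dP] := kP y; split.
    apply: (orbchart_open_map (aYc _ ady)); first exact: open_ball_rV.
    by move=> s /= /ltW; exact: dP.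
  by exists (t y) => //=; rewrite subrr normr0.
have cK : compact (snd @` closure B).
  apply: continuous_compact => //; apply: continuous_subspaceT => z; exact: cvg_snd.
have [s sP] := compact_finite_cover cK oN.
(* the union, over the finitely many balls of the cover, of the pieces of [B]
   read in [c] times the chart of the ball *)
pose P := [set z : 'rV[R]_(n + m) | exists2 y, y \in s &
  [/\ `|lsubmx z - set_val v| < r, `|rsubmx z - t y| < rho y &
      B (oc_map c (lsubmx z), oc_map (d y) (rsubmx z))]].
exists [set z : oc_dom c * 'rV[R]_m | P (row_mx (set_val z.1) z.2)]; split.
- have [M MP] := seq_bounded s (fun y => `|t y| + rho y).
  apply: (@relatively_compact_prod _ _
    (set_val @^-1` [set w : 'rV[R]_n | `|w - set_val v| <= r])
    [set w : 'rV[R]_m | `|w - 0| <= M]).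
  + apply: closed_comp; first by move=> w _; exact: set_val_continuous.
    exact: closed_ball_rV_closed.
  + exact: closed_ball_rV_closed.
  + apply: (compact_set_val oc v); last exact: closed_ball_rV_compact.
    by move=> w /rP[].
  + exact: closed_ball_rV_compact.
  + move=> [w u] [y ys] /=; rewrite row_mxKl row_mxKr => -[wr ur _].
    split => /=; first exact: ltW.
    rewrite subr0 -(subrK (t y) u); apply: le_trans (ler_normD _ _) _.
    by have := MP y ys; move: ur; lra.
- apply: semianalytic_prod_std => z cz; apply: semian_at_bigU => y _.
  have [ady _ ry dP] := kP y.
  have [zr|zr] := leP `|rsubmx z - t y| (rho y); last first.
    (* outside the closed ball the piece is empty *)
    apply: semian_at_empty.
    have oT : open [set w : 'rV[R]_(n + m) | rho y < `|rsubmx w - t y|].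
      apply: (@open_comp _ _ rsubmx [set u | rho y < `|u - t y|]).
        by move=> w _; exact: rsubmx_continuous.
      exact: open_ball_rVC.
    apply: filterS (open_nbhs_nbhs (conj oT zr)) => w wr [_ wr' _].
    by move: (lt_trans wr wr'); rewrite ltxx.
  have dz := dP _ zr.
  pose cd := prod_orbchart c (d y).
  have Fcd : prod_orbifold aX aY cd.
    by exists c, (d y); split => //; exact: maximal_atlas_sub.
  have cdz : oc_dom cd z by [].
  have sBz := orb_semianalytic_preim (coherent_prod haX haY) sB Fcd cdz.
  have [[[ocd _] _ _ _ _] _] := prod_orbchart_analytic hc (aYc _ ady).
  have b1 : semian_at (@std_manifold R (n + m))
      [set w | `|lsubmx w - set_val v| < r] z.
    apply: (@semian_at_analytic _ _ _ lsubmx setT [set w | `|w - set_val v| < r]) => //.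
    - exact: openT.
    - by move=> j w _; exact: analytic_lsubmx.
    - exact: semian_at_ball.
  have b2 : semian_at (@std_manifold R (n + m)) [set w | `|rsubmx w - t y| < rho y] z.
    apply: (@semian_at_analytic _ _ _ rsubmx setT [set w | `|w - t y| < rho y]) => //.
    - exact: openT.
    - by move=> j w _; exact: analytic_rsubmx.
    - exact: semian_at_ball.
  apply: semian_at_near (semian_atI b1 (semian_atI b2 sBz)).
  apply: filterS (open_nbhs_nbhs (conj ocd cdz)) => w cdw.
  by split=> [[? [? []]]|[]].
- apply/seteqP; split=> [w [[Aw _] wr]|_ [[w u] [y ys] /= + <-]].
    have [cw Uw] := rP _ (ltW wr).
    have : (A `&` U) (oc_map c (set_val w)) by [].
    rewrite AU => -[[x' y'] Bxy /= xw].
    have [|y ys [u uy uy']] := sP y'.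
      by exists (x', y') => //; exact: subset_closure.
    exists (w, u) => //; exists y => //; rewrite row_mxKl row_mxKr; split => //.
    by rewrite uy' -xw.
  rewrite row_mxKl row_mxKr => -[wr ur Bw]; split => //.
  have : (A `&` U) (oc_map c (set_val w)).
    by rewrite AU; exists (oc_map c (set_val w), oc_map (d y) u).
  by move=> [Aw _]; split => //; exists (set_val w) => //; exact: set_valP.
Qed.

Lemma maximal_atlas_analytic (c : orbchart R n X) :
  maximal_atlas aX c -> analytic_orbifold_chart c.
Proof. by move=> [F [[Fc _ _] _ /Fc]]. Qed.

Lemma norm_row_mx0 k l (a : 'rV[R]_k) : `|row_mx a (0 : 'rV[R]_l)| <= `|a|.
Proof.
apply: normr_le_rV => // j; case: (split_ordP j) => i ->.
  by rewrite row_mxEl; exact: normr_coord_le.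
by rewrite row_mxEr mxE normr0.
Qed.

Lemma norm_lsubmx_le k l (a : 'rV[R]_(k + l)) : `|lsubmx a| <= `|a|.
Proof. by apply: normr_le_rV => // j; rewrite mxE; exact: normr_coord_le. Qed.

Lemma projections_of_orb_subanalytic :
  orb_subanalytic aX A ->
  forall x : X, exists2 U : set X, nbhs x U &
    exists (m : nat) (Y : topologicalType) (aY : orbatlas R m Y),
      analytic_orbifold aY /\
      exists B : set (X * Y)%type,
        [/\ relatively_compact B,
            orb_semianalytic (prod_orbifold aX aY) B &
            A `&` U = fst @` B].
Proof.
move=> hA x; have [_ hausX _ _ haX] := hX; have [aXc aXx _] := haX.
have [c mc [[v0' cv0 v0x] sA]] := hA x.
have hc := maximal_atlas_analytic mc; have [[[oc _] _ _ _ _] _] := hc.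
pose v0 : oc_dom c := exist _ v0' (mem_set cv0).
have [U' nU' [m [N [aN [[_ aNc aNx _] [B' [cB' sB' AU']]]]]]] := sA v0.
have [P [oP Pv0] PU'] := nbhs_set_val nU'.
exists (oc_map c @` (set_val @` U')).
  have : nbhs x (oc_map c @` (P `&` oc_dom c)).
    apply: open_nbhs_nbhs; split; last by exists v0'.
    by apply: (orbchart_open_map hc) => [|u []//]; exact: openI.
  apply: filterS => _ [u [Pu cu] <-]; exists u => //.
  by exists (to_sub v0 u); [apply: PU' => /=|]; rewrite to_subK.
(* [m + 1], as [N] may have dimension 0 *)
exists (m + 1)%N, 'rV[R]_(m + 1), (@rV_orbatlas R (m + 1)).
split; first by apply: rV_orbifold; rewrite addn1.
have hE := rV_orbatlas_atlas R (m + 1).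
(* around each point of [N], a chart [(k y).1] and the radius [(k y).2] of a
   closed ball contained in its image *)
have /choice[k kP] : forall y : N, exists k : mchart R m N * R,
    [/\ aN k.1, mc_dom k.1 y, 0 < k.2 &
      forall t : 'rV[R]_m, `|t - mc_map k.1 y| <= k.2 ->
        (mc_map k.1 @` mc_dom k.1) t].
  move=> y; have [d ad dy] := aNx y; have [_ oid _ _] := aNc d ad.
  have : nbhs (mc_map d y) (mc_map d @` mc_dom d).
    by apply: open_nbhs_nbhs; split => //; exists y.
  move=> /nbhs_normP[e /= e0 eP]; exists (d, e / 2); split => //=.
    by rewrite divr_gt0.
  by move=> s st; apply: eP => /=; rewrite distrC; apply: le_lt_trans st _; lra.
pose d y := (k y).1; pose rho y := (k y).2.
pose NN y := [set y' | mc_dom (d y) y' /\ `|mc_map (d y) y' - mc_map (d y) y| < rho y].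
have oNN y : open_nbhs y (NN y).
  have [ad dy ry dP] := kP y; split; last by split => //; rewrite subrr normr0.
  have [_ _ _ hd] := aNc _ ad; apply/hd => [y' []//|].
  rewrite (_ : _ @` _ = [set t | `|t - mc_map (d y) y| < rho y]).
    exact: open_ball_rV.
  apply/seteqP; split=> [_ [y' [_ ?] <-]//|t /= tr].
  by have [y' dy' y't] := dP t (ltW tr); exists y' => //; split => //; rewrite y't.
have cK : compact (snd @` closure B').
  apply: continuous_compact => //; apply: continuous_subspaceT => z; exact: cvg_snd.
have [s sP] := compact_finite_cover cK oNN.
pose b y : 'rV[R]_(m + 1) := row_mx (mc_map (d y) y) 0.
(* [B'] read in the chart [d y] *)
pose E y : set 'rV[R]_(n + m) := [set z | exists v y',
  [/\ B' (v, y'), mc_dom (d y) y' & z = row_mx (set_val v) (mc_map (d y) y')]].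
(* The first [m] coordinates of [R^(m + 1)] are those of the chart [d y]; the
   spare one is only constrained by the ball. *)
pose B : set (X * 'rV[R]_(m + 1)) := [set z | exists2 y, y \in s &
  `|z.2 - b y| < rho y /\
  exists u, [/\ oc_dom c u, oc_map c u = z.1 & E y (row_mx u (lsubmx z.2))]].
pose K := oc_map c @` (set_val @` (fst @` closure B')).
have cKX : compact K.
  apply: continuous_compact.
    apply: continuous_in_subspaceT => u /set_mem[v _ <-].
    by apply: (orbchart_continuous hc); exact: set_valP.
  apply: continuous_compact.
    by apply: continuous_subspaceT; exact: set_val_continuous.
  by apply: continuous_compact => //; apply: continuous_subspaceT => z; exact: cvg_fst.
have BK z : B z -> K z.1.
  move=> [y ys [_ [u [cu uz [v [y' [Bvy _ /eq_row_mx[uv _]]]]]]]].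
  exists u => //; exists v => //; exists (v, y') => //; exact: subset_closure.
have clK : closed K by exact: compact_closed.
exists B; split.
- have [M MP] := seq_bounded s (fun y => `|b y| + rho y).
  apply: (@relatively_compact_prod _ _ K
    [set w : 'rV[R]_(m + 1) | `|w - 0| <= M]) => //.
  + exact: closed_ball_rV_closed.
  + exact: closed_ball_rV_compact.
  + move=> [x' w] Bz; split; first exact: BK Bz.
    have [y ys [/= wr _]] := Bz.
    rewrite /= subr0 -(subrK (b y) w); apply: le_trans (ler_normD _ _) _.
    by have := MP y ys; move: wr; lra.
- (* Over [c] the preimage of [B] is a finite union, over the balls and over the
     group of [c], of pullbacks of the sets [E y]. *)
  have sQ z : oc_dom c (lsubmx z) -> semian_at (@std_manifold R (n + (m + 1)))
      (chart_preim (prod_orbchart c (rV_orbchart R (m + 1))) B) z.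
    move=> cz.
    pose T (g : oc_grp c) (w : 'rV[R]_(n + (m + 1))) : 'rV[R]_(n + m) :=
      row_mx (oc_act c g (lsubmx w)) (lsubmx (rsubmx w)).
    pose D := [set w : 'rV[R]_(n + (m + 1)) | oc_dom c (lsubmx w)].
    have oD : open D by apply: open_comp => // w _; exact: lsubmx_continuous.
    have [_ ac] := hc; have [[_ [cg _ _ _] _ cmc _] _] := hc.
    have aT g : analytic_map D (T g).
      move=> j w Dw; apply: analytic_row_mx => i.
        apply: (@analytic_at_comp _ _ _ (fun u => oc_act c g u 0 i) lsubmx).
          exact: ac.
        exact: analytic_lsubmx.
      apply: (@analytic_at_comp _ _ _ (fun u => lsubmx u 0 i) rsubmx).
        exact: analytic_lsubmx.
      exact: analytic_rsubmx.
    apply: (@semian_at_near _ _ _ _ [set w | exists2 y, y \in s &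
        exists2 g, g \in enum (oc_grp c) &
          ([set w | `|rsubmx w - b y| < rho y] `&` (T g) @^-1` E y) w]).
      apply: filterS (open_nbhs_nbhs (conj oD cz)) => w Dw.
      split=> [[y ys [g _ [wr Ew]]]|[[_ _] [y ys [/= wr [u [cu uw Ew]]]]]].
        split; first by split.
        exists y => //; split => //; exists (oc_act c g (lsubmx w)); split => //.
          exact: cg.
        by apply/esym/cmc => //; [exact: cg|exists g].
      have [g ug] : exists g, u = oc_act c g (lsubmx w) by apply/cmc.
      exists y => //; exists g; first by rewrite mem_enum.
      by split => //; rewrite /T /preimage /= -ug.
    apply: semian_at_bigU => y _; apply: semian_at_bigU => g _.
    have [ady dy ry dP] := kP y.
    have [zr|zr] := leP `|rsubmx z - b y| (rho y); last first.
      apply: semian_at_empty.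
      have oT : open [set w : 'rV[R]_(n + (m + 1)) | rho y < `|rsubmx w - b y|].
        apply: (@open_comp _ _ rsubmx [set u | rho y < `|u - b y|]).
          by move=> w _; exact: rsubmx_continuous.
        exact: open_ball_rVC.
      apply: filterS (open_nbhs_nbhs (conj oT zr)) => w wr [wr' _].
      by move: (lt_trans wr wr'); rewrite ltxx.
    apply: semian_atI.
      apply: (@semian_at_analytic _ _ _ rsubmx setT [set w | `|w - b y| < rho y]) => //.
      - exact: openT.
      - by move=> j w _; exact: analytic_rsubmx.
      - exact: semian_at_ball.
    apply: (semian_at_analytic oD) => //.
    apply: (semian_at_prod_chart oc v0 ady (aNc _ ady)) => //.
      by rewrite /T row_mxKl; exact: cg.
    rewrite /T row_mxKr; apply: dP; apply: le_trans zr.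
    by have := norm_lsubmx_le (rsubmx z - b y); rewrite linearB /= /b row_mxKl.
  move=> [x' w]; have [c' ac' cx'] := aXx x'.
  pose e := prod_orbchart c' (rV_orbchart R (m + 1)).
  exists e; first exact: prod_chart_maximal.
  split; first by rewrite prod_img; split => //=; exists w.
  have hc' := aXc c' ac'; have [[[oc' _] _ _ _ _] _] := hc'.
  have [[[oe _] _ _ _ _] _] :=
    prod_orbchart_analytic hc' (rV_orbchart_analytic R (m + 1)).
  apply/semianalytic_chart_preimage => // z ez; have [c'z _] := ez.
  have [[v1 [v _ vv1] v1z]|nK] := pselect (K (oc_map c' (lsubmx z))).
    have cv1 : oc_dom c v1 by rewrite -vv1; exact: set_valP.
    have mE : maximal_atlas (@rV_orbatlas R (m + 1)) (rV_orbchart R (m + 1)).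
      exact: maximal_atlas_sub.
    have tr : chart_transition e z (prod_orbchart c (rV_orbchart R (m + 1)))
        (row_mx v1 (rsubmx z)).
      apply: (coherent_prod haX hE) => //.
      - exists c', (rV_orbchart R (m + 1)); split => //; exact: maximal_atlas_sub.
      - by exists c, (rV_orbchart R (m + 1)).
      - by rewrite /= row_mxKl.
      - by rewrite /= row_mxKl row_mxKr v1z.
    by apply: (semian_at_transition tr); apply: sQ; rewrite row_mxKl.
  (* [B] lies over the compact set [K], hence is empty near [z] *)
  apply: semian_at_empty.
  have oT : open (oc_dom e `&` (oc_map c' \o lsubmx) @^-1` (~` K)).
    apply: continuous_openI => //; first exact: closed_openC.
    move=> u [cu _]; apply: continuous_comp; first exact: lsubmx_continuous.
    exact: orbchart_continuous.
  apply: filterS (open_nbhs_nbhs (conj oT (conj ez nK))) => u [_ nKu] [_ Bu].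
  by apply: nKu; exact: BK Bu.
- apply/seteqP; split=> [a [Aa [_ [v U'v <-] va]]|_ [[x' w] Bz <-]].
    have : (chart_preimage c A `&` U') v.
      split=> //; split; first by rewrite va.
      by exists (set_val v) => //; exact: set_valP.
    rewrite AU' => -[[v1 y'] Bvy /= v1v]; rewrite v1v in Bvy.
    have [|y ys [dy' yr]] := sP y'.
      by exists (v, y') => //; exact: subset_closure.
    exists (a, row_mx (mc_map (d y) y') 0) => //.
    exists y => //; split => /=.
      apply: le_lt_trans yr; rewrite /b opp_row_mx add_row_mx subr0.
      exact: norm_row_mx0.
    exists (set_val v); split => //; first exact: set_valP.
    by exists v, y'; rewrite row_mxKl.
  have [y ys [_ [u [cu ux [v [y' [Bvy _ /eq_row_mx[uv _]]]]]]]] := Bz.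
  have : (chart_preimage c A `&` U') v by rewrite AU'; exists (v, y').
  move=> [[Av _] U'v]; rewrite /= -[x']/((x', w).1) -ux uv.
  by split => //; exists (set_val v) => //; exists v.
Qed.

End Projection.

Theorem theorem10p1 (R : realType) (n : nat) (X : topologicalType)
    (aX : orbatlas R n X) (hX : analytic_orbifold aX) (A : set X) :
  orb_subanalytic aX A <->
  forall x : X, exists2 U : set X, nbhs x U &
    exists (m : nat) (Y : topologicalType) (aY : orbatlas R m Y),
      analytic_orbifold aY /\
      exists B : set (X * Y)%type,
        [/\ relatively_compact B,
            orb_semianalytic (prod_orbifold aX aY) B &
            A `&` U = fst @` B].
Proof.
split; first exact: projections_of_orb_subanalytic.
exact: orb_subanalytic_of_projections.
Qed.
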